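(* Let $\mu$ be a measure of $n$-polynomial growth on $\mathbb{R}^d$ and let $\Sigma=\{\Sigma_k\}_{k\in\mathbb{Z}}$ be the doubling atomic filtration of $\mathrm{supp}(\mu)$ described in the context. Let $0\le f\in L_1(\mu)$ and $\lambda>0$ (or $\lambda>\|f\|_{L_1(\mu)}/\|\mu\|$ if $\mu$ is finite). Consider the family of maximal sets of $\Pi(\Sigma)$ with respect to the property $\langle f\rangle_Q>\lambda$. We can write $f=g+\tilde\beta$, where $$\tilde\beta=\sum_{k\in\mathbb{Z}}\varphi_k=\sum_{k\in\mathbb{Z}}\ \sum_{\substack{Q\in\Pi(\Sigma_k)\\ Q\ \text{maximal}}}\Big(f\chi_Q-\mathsf{E}_{\Sigma_{k-1}}[f\chi_Q]\Big),\qquad g=f-\tilde\beta,$$ and we have $$\sum_{k\in\mathbb{Z}}\|\varphi_k\|_{L_1(\mu)}\lesssim\|f\|_{L_1(\mu)}\qquad\text{and}\qquad\|g\|_{L_2(\mu)}^2\lesssim\lambda\|f\|_{L_1(\mu)}.$$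
   Context: **Measure.** $\mu$ is a Radon measure on $\mathbb{R}^d$ with $\mu(B(x,r))\le r^n$ for all $x\in\mathbb{R}^d$, $r>0$, where $n>0$ is fixed; $\|\mu\|$ is its total mass. Sets are identified with their intersection with $\mathrm{supp}(\mu)$ and relations between sets are understood up to $\mu$-null sets. For a ball $B=B(x,r)$, $cB=B(x,cr)$. A ball $B$ is $(\alpha,\beta)$-doubling if $\mu(\alpha B)\le\beta\mu(B)$. $\langle f\rangle_Q=\mu(Q)^{-1}\int_Qf\,d\mu$. **The filtration $\Sigma$.** Fix $\alpha=2\cdot 28^2$ and $\beta=\alpha^{d+1}$. Let $\mathscr{D}=\{\mathscr{D}_k\}_{k\in\mathbb{Z}}$ be the (David-Mattila type) sequence of nested partitions of $\mathrm{supp}(\mu)$ constructed for these parameters, whose elements are called cubes. For some $A\gg\beta$ of the form $A=\alpha^{(d+1)m}$ it has these properties: any two cubes are nested or disjoint; each $Q\in\mathscr{D}_k$ has a ball $B_Q=B(x_Q,r(Q))$, $x_Q\in\mathrm{supp}(\mu)$, $r(Q)\sim_\beta A^{-k}$, with $B_Q\subset Q\subset 28B_Q$, and the balls $5B_Q$ of cubes of the same generation are pairwise disjoint; for each $Q$ either $B_Q$ is $(\alpha,\beta)$-doubling or $\mu(\alpha B_Q)<\beta^{-i}\mu(\alpha^{i+1}B_Q)$ for all integers $i\ge1$ with $\alpha^i\le\beta$; for every cube $Q$, $\mathrm{supp}(\mu)$ is contained in the union of all cubes containing $Q$. A cube $Q$ is called doubling if $B_Q$ is $(\alpha,\beta)$-doubling;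 every cube is, up to a $\mu$-null set, a disjoint union of doubling cubes, and is contained in some doubling cube. The filtration $\Sigma$ consists of doubling cubes only: start with a doubling cube $Q_0\in\Pi(\Sigma_0)$; its first ancestor is the smallest doubling cube of $\mathscr{D}$ properly containing it, which belongs to $\Pi(\Sigma_{-1})$, and inductively the $(j+1)$-th ancestor is the smallest doubling cube properly containing the $j$-th one and belongs to $\Pi(\Sigma_{-j-1})$; the children of $Q\in\Pi(\Sigma)$ are the maximal doubling cubes of $\mathscr{D}$ properly contained in $Q$; a cube belongs to $\Pi(\Sigma_k)$ if its parent $\widehat Q$ (the smallest cube of $\Pi(\Sigma)$ properly containing it) belongs to $\Pi(\Sigma_{k-1})$. Here $\Pi(\Sigma_k)$ is the set of atoms of $\Sigma_k$ and $\Pi(\Sigma)=\bigcup_k\Pi(\Sigma_k)$. This filtration is increasing, $\bigcup_k L_\infty(\mathbb{R}^d,\Sigma_k,\mu)$ is weak-$*$ dense in $L_\infty(\mu)$, each $Q\in\Pi(\Sigma)$ satisfies $B_Q\subset Q\subset 28B_Q$ with $B_Q$ $(\alpha,\beta)$-doubling, and $\int_{\alpha B_{\widehat Q}\setminus 56B_Q}|x-y|^{-n}d\mu(y)\lesssim_{n,d,\alpha,\beta}1$ for $x\in Q\in\Pi(\Sigma)$. $\mathsf{E}_{\Sigma_k}$ is the conditional expectation onto $\Sigma_k$: $\mathsf{E}_{\Sigma_k}f=\sum_{Q\in\Pi(\Sigma_k)}\langle f\rangle_Q\chi_Q$. The function $\varphi_k$ is the inner sum over maximal $Q\in\Pi(\Sigma_k)$.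 The implicit constants in $\lesssim$ do not depend on $f$ or $\lambda$. *)

(* Defs.v *)
From HB Require Import structures.
From mathcomp Require Import all_boot all_order all_algebra.
From mathcomp Require Import all_classical all_reals all_analysis.
Import Order.TTheory GRing.Theory Num.Theory.
Import numFieldNormedType.Exports.

Set Implicit Arguments.
Unset Strict Implicit.
Unset Printing Implicit Defensive.

Local Open Scope classical_set_scope.
Local Open Scope ring_scope.

(* R^d with its Borel sigma-algebra. The underlying type is 'rV[R]_d, whose
   library norm is the sup norm, hence the Euclidean distance below. *)
Definition borelRd (R : realType) (d : nat) : measurableType _ :=
  g_sigma_algebraType (@open 'rV[R]_d).

Definition edist (R : realType) (d : nat) (x y : 'rV[R]_d) : R :=
  Num.sqrt (\sum_(i < d) (x ord0 i - y ord0 i) ^+ 2).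

Definition eball (R : realType) (d : nat) (x : 'rV[R]_d) (r : R) :
    set (borelRd R d) :=
  [set y : 'rV[R]_d | edist x y < r].

(* The sum of a real family over a possibly infinite set of indices: the
   unconditional sum if the family is summable, a junk value otherwise. *)
Definition rsum (R : realType) (I : choiceType) (A : set I) (u : I -> R) : R :=
  fine (\esum_(i in A) ((EFin \o u)^\+ i) - \esum_(i in A) ((EFin \o u)^\- i))%E.

Section Measures.
Context (R : realType) (d : nat).
Local Notation E := (borelRd R d).
Variable mu : {measure set E -> \bar R}.

Definition radon : Prop :=
  [/\ (forall K : set 'rV[R]_d, compact K -> (mu K < +oo)%E),
      (forall A : set E, measurable A ->
         mu A = ereal_inf [set mu U | U in
                  [set U : set 'rV[R]_d | open U /\ A `<=` U]]) &
      (forall U : set 'rV[R]_d, open U ->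
         mu U = ereal_sup [set mu K | K in
                  [set K : set 'rV[R]_d | compact K /\ K `<=` U]])].

Definition polynomial_growth (n : R) : Prop :=
  forall (x : 'rV[R]_d) (r : R), 0 < r -> (mu (eball x r) <= (r `^ n)%:E)%E.

Definition msupport : set E :=
  [set x : 'rV[R]_d | forall r : R, 0 < r -> (0 < mu (eball x r))%E].

(* Relations between sets up to mu-null sets. As the complement of
   [msupport] is mu-null, they do not distinguish a set from its
   intersection with [msupport]. *)
Definition aesub (A B : set E) : Prop := mu.-negligible (A `\` B).
Definition aeeq (A B : set E) : Prop := aesub A B /\ aesub B A.
Definition aedisj (A B : set E) : Prop := mu.-negligible (A `&` B).
Definition aeproper (A B : set E) : Prop := aesub A B /\ ~ aesub B A.

Definition doubling_ball (a b : R) (x : 'rV[R]_d) (r : R) : Prop :=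
  (mu (eball x (a * r)) <= b%:E * mu (eball x r))%E.

Definition avg (f : E -> R) (Q : set E) : R :=
  (fine (mu Q))^-1 * \int[mu]_(x in Q) f x.

End Measures.

Definition alpha (R : realType) : R := 2 * 28 ^+ 2.
Definition beta (R : realType) (d : nat) : R := alpha R ^+ d.+1.

Section Lattice.
Context (R : realType) (d : nat).
Local Notation E := (borelRd R d).
Local Notation alpha := (alpha R).
Local Notation beta := (beta R d).
Variable mu : {measure set E -> \bar R}.

(* [D k] is the family of cubes of generation [k]. The same set may be a cube
   of several generations, so the ball B_Q = B(cen k Q, rad k Q) may depend on
   the generation in which [Q] is considered. *)
Variables (D : int -> set (set E)).
Variables (cen : int -> set E -> 'rV[R]_d) (rad : int -> set E -> R).

Definition cubes : set (set E) := \bigcup_(k in [set: int]) D k.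

Definition doubling_cubes : set (set E) :=
  [set Q | exists2 k, D k Q & doubling_ball mu alpha beta (cen k Q) (rad k Q)].

Record david_mattila (A : R) : Prop := DavidMattila {
  (* only beta < A is retained of the requirement that A be much larger *)
  dm_ratio : beta < A /\ exists m : nat, A = alpha ^+ (d.+1 * m);
  dm_measurable : forall Q, cubes Q -> measurable Q;
  (* sets that agree up to a null set are identified, so that no cube is
     counted twice in sums over cubes *)
  dm_identified : forall Q S, cubes Q -> cubes S -> aeeq mu Q S -> Q = S;
  dm_cover : forall k, aeeq mu (\bigcup_(Q in D k) Q) (msupport mu);
  dm_disjoint : forall k Q S, D k Q -> D k S -> Q <> S -> aedisj mu Q S;
  dm_refine : forall k Q, D (k + 1) Q -> exists2 S, D k S & aesub mu Q S;
  dm_nested : forall Q S, cubes Q -> cubes S ->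
    [\/ aesub mu Q S, aesub mu S Q | aedisj mu Q S];
  dm_center : forall k Q, D k Q -> msupport mu (cen k Q);
  dm_radius : exists2 c : R, 0 < c & forall k Q, D k Q ->
    c^-1 * A ^ (- k) <= rad k Q /\ rad k Q <= c * A ^ (- k);
  dm_ball : forall k Q, D k Q ->
    aesub mu (eball (cen k Q) (rad k Q)) Q /\
    aesub mu Q (eball (cen k Q) (28 * rad k Q));
  dm_ball_disjoint : forall k Q S, D k Q -> D k S -> Q <> S ->
    aedisj mu (eball (cen k Q) (5 * rad k Q)) (eball (cen k S) (5 * rad k S));
  dm_doubling : forall k Q, D k Q ->
    doubling_ball mu alpha beta (cen k Q) (rad k Q) \/
    (forall i : nat, (1 <= i)%N -> alpha ^+ i <= beta ->
      (mu (eball (cen k Q) (alpha * rad k Q)) <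
       (beta ^- i)%:E * mu (eball (cen k Q) (alpha ^+ i.+1 * rad k Q)))%E);
  dm_exhaust : forall Q, cubes Q ->
    aesub mu (msupport mu)
      (\bigcup_(S in [set S | cubes S /\ aesub mu Q S]) S);
  dm_doubling_partition : forall Q, cubes Q ->
    exists F : set (set E), [/\ F `<=` doubling_cubes,
      (forall P S, F P -> F S -> P <> S -> aedisj mu P S) &
      aeeq mu Q (\bigcup_(P in F) P)];
  dm_doubling_above : forall Q, cubes Q ->
    exists2 S, doubling_cubes S & aesub mu Q S }.

Definition smallest_doubling_above (Q P : set E) : Prop :=
  [/\ doubling_cubes P, aeproper mu Q P &
      forall S, doubling_cubes S -> aeproper mu Q S -> aesub mu P S].

Definition maximal_doubling_below (Q P : set E) : Prop :=
  [/\ doubling_cubes P, aeproper mu P Q &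
      forall S, doubling_cubes S -> aeproper mu S Q -> ~ aeproper mu P S].

Inductive sigma_ancestor (Q0 : set E) : nat -> set E -> Prop :=
| sigma_ancestor0 : sigma_ancestor Q0 0 Q0
| sigma_ancestorS j Q P : sigma_ancestor Q0 j Q ->
    smallest_doubling_above Q P -> sigma_ancestor Q0 j.+1 P.

(* [sigma_atoms Q0 k] is the set of atoms of Sigma_k, for the filtration
   generated from the doubling cube [Q0], an atom of Sigma_0. *)
Inductive sigma_atoms (Q0 : set E) : int -> set E -> Prop :=
| sigma_atoms_ancestor j Q : sigma_ancestor Q0 j Q ->
    sigma_atoms Q0 (- j%:Z) Q
| sigma_atoms_child k Q P : sigma_atoms Q0 k Q ->
    maximal_doubling_below Q P -> sigma_atoms Q0 (k + 1) P.

End Lattice.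

Section CalderonZygmund.
Context (R : realType) (d : nat).
Local Notation E := (borelRd R d).
Variable mu : {measure set E -> \bar R}.

(* [Pi k] is the set of atoms of the k-th sigma-algebra of the filtration. *)
Variable Pi : int -> set E -> Prop.

Definition condexp (k : int) (f : E -> R) (x : E) : R :=
  rsum [set Q : set E | Pi k Q] (fun Q => avg mu f Q * \1_Q x).

Variables (f : E -> R) (lambda : R).

Definition maximal_cube (Q : set E) : Prop :=
  [/\ exists k, Pi k Q, lambda < avg mu f Q &
      forall k S, Pi k S -> lambda < avg mu f S -> ~ aeproper mu Q S].

Definition maximal_in (k : int) : set (set E) :=
  [set Q : set E | Pi k Q /\ maximal_cube Q].

Definition cz_term (k : int) (x : E) (Q : set E) : R :=
  f x * \1_Q x - condexp (k - 1) (fun y => f y * \1_Q y) x.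

Definition cz_phi (k : int) (x : E) : R := rsum (maximal_in k) (cz_term k x).

Definition cz_bad (x : E) : R := rsum [set: int] (fun k => cz_phi k x).

Definition cz_good (x : E) : R := f x - cz_bad x.

End CalderonZygmund.

(* Main.v *)
Require Import Defs.
From HB Require Import structures.
From mathcomp Require Import all_boot all_order all_algebra.
From mathcomp Require Import finmap zify ring lra measurable_realfun.
From mathcomp Require Import all_classical all_reals all_analysis.
Import Order.TTheory GRing.Theory Num.Theory.
Import numFieldNormedType.Exports.
Set Implicit Arguments.
Unset Strict Implicit.
Unset Printing Implicit Defensive.
Local Open Scope classical_set_scope.
Local Open Scope ring_scope.

(** The estimates come from the martingale structure of the filtration. All
    relations between sets are up to null sets. Let M be the family of maximal
    cubes Q with average above lambda, and let Q^ be the parent of Q. Since cubes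
    are nested or disjoint, the members of M are pairwise disjoint; since the
    averages over large cubes are at most lambda, every cube of average above
    lambda lies in a member of M and every Q in M has a parent; by maximality the
    average of f over Q^ is at most lambda.

    Only one atom of the previous level, namely Q^, meets Q. So the term of Q is
    f 1_Q - a_Q 1_(Q^), where a_Q mu(Q^) is the integral of f over Q
    ([cz_termE]). Its L1 norm is at most twice that integral, and the integrals
    over M add up to at most the norm of f. This gives the first bound and
    all the summability statements.

    Almost everywhere the good part is f 1_G + h, with G the complement of the
    union of M and h the sum of the functions a_Q 1_(Q^) ([cz_goodE]). On G one
    has f <= lambda ([unstopped_le]): every doubling cube either has average at
    most lambda or is contained in a member of M, so the integral of f 1_G over
    any cube, and then over any open set, is at most lambda times the measure;
    outer regularity extends this to all Borel sets ([bound_ae]). For h, the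
    integral of h^2 is a double sum over pairs (Q, S) of M. Two parents that
    overlap are nested, and the pairs with S^ contained in Q^ contribute a_Q
    times the integral of f over S. For fixed Q these sum to at most a_Q times
    the integral of f over Q^, hence to at most lambda a_Q mu(Q^), which is
    lambda times the integral of f over Q ([esum_inner_term]). So the integral
    of h^2 is at most 2 lambda times the norm of f ([integral_spread_sq]).

    The combinatorial input is that every doubling cube is an atom of exactly
    one level ([doubling_atom], [atom_unique]): any two doubling cubes have a
    common doubling cube above them, and between two nested cubes there are only
    finitely many cubes because generations increase strictly. *)

(** * Sums over countable families *)

Lemma esum_single (R : realType) (I : choiceType) (A : set I) (u : I -> \bar R)
    (a : I) : A a -> (0 <= u a)%E -> (forall i, A i -> i <> a -> u i = 0%E) ->
  (\esum_(i in A) u i = u a)%E.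
Proof.
move=> Aa ua0 u0.
have uge0 i : A i -> (0 <= u i)%E.
  by move=> Ai; have [->//|/eqP ia] := eqVneq i a; rewrite u0.
rewrite (esumID [set a])//= setIidr; last by move=> _ ->.
rewrite esum_set1// esum1 ?adde0// => i [Ai /= ia]; exact: u0.
Qed.

Section CountableSums.
Local Open Scope ereal_scope.
Context (R : realType) (I : choiceType).
Implicit Types (A : set I) (u : I -> \bar R).

Lemma countable_enumeration A : countable A ->
  A = set0 \/ exists (B : set nat) (e : nat -> I), set_bij B A e.
Proof.
move=> cA; have [->|/set0P[a Aa]] := eqVneq A set0; first by left.
right; have /countable_bijP[B] := cA; rewrite card_eq_sym.
pose J : pointedType := HB.pack I (isPointed.Build I a).
move=> AB; have /(@card_set_bijP nat J B A)[e eP] := AB.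
by exists B, e.
Qed.

Lemma esumZ A (c : R) u : (0 <= c)%R -> (forall i, 0 <= u i) ->
  \esum_(i in A) (c%:E * u i) = c%:E * \esum_(i in A) u i.
Proof.
move=> c0 u0; rewrite /esum -ereal_supZl//; last first.
  by apply/set0P; exists (\sum_(x \in set0) u x), set0 => //; exact: fsets_set0.
congr ereal_sup; apply/seteqP; split=> [_ [X [fX XA] <-]|_ [_ [X [fX XA] <-] <-]].
  exists (\sum_(x \in X) u x); first by exists X.
  by rewrite ge0_mule_fsumr.
exists X => //.
by rewrite ge0_mule_fsumr.
Qed.

Lemma esum_exchange (J : choiceType) A (B : set J) (u : I -> J -> \bar R) :
  (forall i j, A i -> B j -> 0 <= u i j) ->
  \esum_(i in A) \esum_(j in B) u i j = \esum_(j in B) \esum_(i in A) u i j.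
Proof.
move=> u0; rewrite !esum_esum//; last by move=> i j Bj Ai; exact: u0.
rewrite (@reindex_esum R (J * I)%type (I * J)%type (B `*`` (fun=> A)) _
  (fun p => (p.2, p.1)))//.
split=> [[j i] [/= Bj Ai]|[j i] [j' i'] _ _ [-> ->]|[i j] [/= Ai Bj]]//.
by exists (j, i).
Qed.

Lemma esum_sub A B u : A `<=` B -> (forall i, B i -> 0 <= u i) ->
  \esum_(i in A) u i <= \esum_(i in B) u i.
Proof.
move=> AB u0; rewrite esum_mkcond [leRHS]esum_mkcond; apply: le_esum => i _.
case: ifPn => [/set_mem/AB Bi|_]; first by rewrite mem_set.
by case: ifPn => // /set_mem; exact: u0.
Qed.

(** For each n only finitely many terms are at least 1/(n+1). *)
Lemma esum_pos_countable A u : (forall i, A i -> 0 < u i) ->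
  \esum_(i in A) u i < +oo -> countable A.
Proof.
move=> u0 sfin; pose L n := [set i | A i /\ n.+1%:R^-1%:E <= u i].
have -> : A = \bigcup_n L n.
  apply/seteqP; split=> [i Ai|i [n _ []]//].
  have := u0 _ Ai; case uE: (u i) => [r| |]// r0.
    rewrite lte_fin in r0.
    have [n nr] := ltr_add_invr r0; rewrite add0r in nr.
    by exists n => //; split=> //; rewrite uE lee_fin ltW.
  by exists 0%N => //; split=> //; rewrite uE leey.
apply: bigcup_countable => // n _; apply: finite_set_countable.
apply: contrapT => Linf.
have sge0 : 0 <= \esum_(i in A) u i by apply: esum_ge0 => i /u0/ltW.
have sE : \esum_(i in A) u i \is a fin_num by rewrite ge0_fin_numE.
pose S := fine (\esum_(i in A) u i).
have [k Sk] : exists k : nat, (n.+1%:R * S < k%:R)%R.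
  exists (Num.bound (n.+1%:R * S)); apply: archi_boundP.
  by rewrite mulr_ge0// fine_ge0.
have [B BL kB] := infinite_set_fset k Linf.
have : (k%:R / n.+1%:R)%:E <= \esum_(i in A) u i.
  apply: esum_ge; exists [set` B].
    by split; [exact: finite_fset|move=> i /BL[]].
  apply: (@le_trans _ _ (\sum_(i \in [set` B]) n.+1%:R^-1%:E)); last first.
    by apply: lee_fsum => // i /BL[].
  rewrite fsbig_finite//= set_fsetK sumEFin big_const_seq count_predT.
  rewrite iter_addr addr0 lee_fin mulr_natl.
  by rewrite ler_wpMn2l ?invr_ge0.
by rewrite -(fineK sE) lee_fin ler_pdivrMr// mulrC leNgt Sk.
Qed.

End CountableSums.

Section IntegralSums.
Local Open Scope ereal_scope.
Context d (T : measurableType d) (R : realType) (mu : {measure set T -> \bar R}).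
Context (I : choiceType).
Implicit Types (A : set I) (u : I -> T -> \bar R).

Lemma measurable_esum A u : countable A ->
  (forall i, A i -> measurable_fun setT (u i)) ->
  (forall i x, A i -> 0 <= u i x) ->
  measurable_fun setT (fun x => \esum_(i in A) u i x).
Proof.
move=> /countable_enumeration[->|[B [e eP]]] mu0 u0.
  by under eq_fun do rewrite esum_set0; exact: measurable_cst.
have eA n : n \in B -> A (e n) by move=> /set_mem; case: eP => + _ _; apply.
rewrite (_ : (fun x => _) = fun x => \sum_(n <oo | n \in B) u (e n) x).
  by apply: ge0_emeasurable_sum => [n x _|n] /eA; [exact: u0|exact: mu0].
apply/funext => x; rewrite (@reindex_esum _ _ _ _ _ _ (u ^~ x) eP) nneseries_esum.
  by rewrite set_mem_set.
by move=> n /eA; exact: u0.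
Qed.

Lemma integral_esum A u : countable A ->
  (forall i, A i -> measurable_fun setT (u i)) ->
  (forall i x, A i -> 0 <= u i x) ->
  \int[mu]_x (\esum_(i in A) u i x) = \esum_(i in A) \int[mu]_x u i x.
Proof.
move=> /countable_enumeration[->|[B [e eP]]] mu0 u0.
  rewrite esum_set0; under eq_integral do rewrite esum_set0.
  exact: integral0.
have eA n : B n -> A (e n) by case: eP => + _ _; apply.
pose v n x := if n \in B then u (e n) x else 0.
have v0 n x : 0 <= v n x.
  by rewrite /v; case: ifPn => // /set_mem Bn; exact/u0/eA.
rewrite (_ : (fun x => _) = fun x => \sum_(n <oo) v n x); last first.
  apply/funext => x; rewrite (@reindex_esum _ _ _ _ _ _ (u ^~ x) eP) esum_mkcond.
  by rewrite nneseries_esumT.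
rewrite integral_nneseries//; last first.
  move=> n; rewrite /v; case: (boolP (n \in B)) => [/set_mem Bn|_].
    exact/mu0/eA.
  exact: measurable_cst.
rewrite (@reindex_esum R nat I B A e (fun i => \int[mu]_x u i x) eP).
rewrite esum_mkcond nneseries_esumT; last first.
  by move=> n; exact: integral_ge0.
apply: eq_esum => n _; rewrite /v; case: (n \in B) => //.
by rewrite integral0.
Qed.

End IntegralSums.

(** * Relations up to null sets *)

Section CountableNegligible.
Context d (T : measurableType d) (R : realType) (mu : {measure set T -> \bar R}).

Lemma negligible_countable_bigcup (I : choiceType) (A : set I)
    (F : I -> set T) : countable A ->
  (forall i, A i -> mu.-negligible (F i)) ->
  mu.-negligible (\bigcup_(i in A) F i).
Proof.
move=> /countable_enumeration[->|[B [e [eA _ eS]]]] F0.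
  by rewrite bigcup_set0; exact: negligible_set0.
pose G n := if n \in B then F (e n) else set0.
apply: (@negligibleS _ _ _ _ (\bigcup_n G n)).
  move=> x [i /eS[n Bn <-] Fx]; exists n => //.
  by rewrite /G mem_set.
apply: negligible_bigcup => n; rewrite /G.
case: ifPn => [/set_mem Bn|_]; last exact: negligible_set0.
exact/F0/eA.
Qed.

End CountableNegligible.

Section NullRelations.
Context (R : realType) (d : nat).
Local Notation E := (borelRd R d).
Variable mu : {measure set E -> \bar R}.
Implicit Types (A B C : set E) (F : set (set E)).

Lemma subset_aesub A B : A `<=` B -> aesub mu A B.
Proof.
by move=> AB; rewrite /aesub (_ : A `\` B = set0) ?setD_eq0//; exact: negligible_set0.
Qed.

Lemma aesub_refl A : aesub mu A A.
Proof. exact: subset_aesub. Qed.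

Lemma aesub_trans B A C : aesub mu A B -> aesub mu B C -> aesub mu A C.
Proof.
move=> AB BC; apply: negligibleS (negligibleU AB BC) => x [Ax Cx].
by have [Bx|Bx] := pselect (B x); [right|left].
Qed.

Lemma aedisj_sym A B : aedisj mu A B -> aedisj mu B A.
Proof. by rewrite /aedisj setIC. Qed.

Lemma aedisjS A B A' B' : aesub mu A A' -> aesub mu B B' ->
  aedisj mu A' B' -> aedisj mu A B.
Proof.
move=> AA' BB' dAB.
apply: negligibleS (negligibleU (negligibleU AA' BB') dAB) => x [Ax Bx].
have [A'x|] := pselect (A' x); last by left; left.
have [B'x|] := pselect (B' x); last by left; right.
by right.
Qed.

Lemma aesub_bigcup F B : countable F -> (forall Q, F Q -> aesub mu Q B) ->
  aesub mu (\bigcup_(Q in F) Q) B.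
Proof.
move=> cF FB; apply: negligibleS (negligible_countable_bigcup cF FB).
by move=> x [[Q FQ Qx] Bx]; exists Q.
Qed.

Lemma ae_le_integral A B (f : E -> \bar R) : measurable A -> measurable B ->
  measurable_fun setT f -> (forall x, 0 <= f x)%E -> aesub mu A B ->
  (\int[mu]_(x in A) f x <= \int[mu]_(x in B) f x)%E.
Proof.
move=> mA mB mf f0 AB; rewrite integral_mkcond [leRHS]integral_mkcond.
apply: ae_ge0_le_integral => //.
- by move=> x _; rewrite /patch; case: ifP.
- by apply/(measurable_restrictT _ mA); exact: measurable_funTS.
- by move=> x _; rewrite /patch; case: ifP.
- by apply/(measurable_restrictT _ mB); exact: measurable_funTS.
apply: negligibleS AB => x /= /not_implyP[_ H]; apply: contrapT => ABx.
apply: H; rewrite /patch; case: ifPn => [/set_mem Ax|_]; last by case: ifP.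
by rewrite mem_set//; apply: contrapT => Bx; exact: ABx.
Qed.

Lemma ae_le_measure A B : measurable A -> measurable B -> aesub mu A B ->
  (mu A <= mu B)%E.
Proof.
move=> mA mB AB.
have := @ae_le_integral A B (cst 1%E) mA mB (measurable_cst _) (fun=> lee01) AB.
by rewrite !integral_cst// !mul1e.
Qed.

Definition pairwise_aedisj F :=
  forall P S, F P -> F S -> P <> S -> aedisj mu P S.

(** Discarding the countably many pairwise intersections, each point lies in at
    most one member of the family. *)
Lemma pairwise_aedisj_ae F : countable F -> pairwise_aedisj F ->
  {ae mu, forall x, forall P S, F P -> F S -> P x -> S x -> P = S}.
Proof.
move=> cF dF.
have cFF : countable (F `*`` (fun=> F)).
  exact: countableXR.
have := @negligible_countable_bigcup _ _ _ mu _ (F `*`` (fun=> F))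
  (fun p => if p.1 == p.2 then set0 else p.1 `&` p.2) cFF.
move=> N; apply: negligibleS (N _) => [x /= /existsNP[P /existsNP[S]]|[P S] [/= FP FS]].
  move=> /not_implyP[FP /not_implyP[FS /not_implyP[Px /not_implyP[Sx PS]]]].
  exists (P, S) => //=; case: eqP => //.
case: eqP => [_|PS]; first exact: negligible_set0.
exact: dF.
Qed.

Lemma aesub_bigcup_ae F B : countable F -> (forall Q, F Q -> aesub mu Q B) ->
  {ae mu, forall x, forall Q, F Q -> Q x -> B x}.
Proof.
move=> cF FB; apply: negligibleS (negligible_countable_bigcup cF FB) => x /=.
by move=> /existsNP[Q /not_implyP[FQ /not_implyP[Qx Bx]]]; exists Q.
Qed.

Lemma measurable_patch A (f : E -> \bar R) : measurable A ->
  measurable_fun setT f -> measurable_fun setT (f \_ A).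
Proof.
by move=> mA mf; apply/(measurable_restrictT _ mA); exact: measurable_funTS.
Qed.

Lemma patch_ge0 A (f : E -> \bar R) x : (forall x, 0 <= f x)%E ->
  (0 <= (f \_ A) x)%E.
Proof. by move=> f0; rewrite /patch; case: ifP. Qed.

Section Families.
Variables (F : set (set E)) (f : E -> \bar R).
Hypotheses (cF : countable F) (mF : forall Q, F Q -> measurable Q).
Hypotheses (mf : measurable_fun setT f) (f0 : forall x, (0 <= f x)%E).

Lemma integral_esum_patch :
  (\esum_(Q in F) \int[mu]_(x in Q) f x =
   \int[mu]_x (\esum_(Q in F) (f \_ Q) x))%E.
Proof.
under eq_esum do rewrite integral_mkcond.
rewrite -integral_esum// => [Q FQ|Q x FQ]; last exact: patch_ge0.
by apply: measurable_patch => //; exact: mF.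
Qed.

Lemma measurable_esum_patch : measurable_fun setT
  (fun x => \esum_(Q in F) (f \_ Q) x)%E.
Proof.
apply: measurable_esum => // [Q FQ|Q x FQ]; last exact: patch_ge0.
by apply: measurable_patch => //; exact: mF.
Qed.

Lemma esum_integral_le B : pairwise_aedisj F ->
  measurable B -> (forall Q, F Q -> aesub mu Q B) ->
  (\esum_(Q in F) \int[mu]_(x in Q) f x <= \int[mu]_(x in B) f x)%E.
Proof.
move=> dF mB FB; rewrite integral_esum_patch [leRHS]integral_mkcond.
apply: ae_ge0_le_integral => //.
- by move=> x _; apply: esum_ge0 => Q _; exact: patch_ge0.
- exact: measurable_esum_patch.
- by move=> x _; exact: patch_ge0.
- exact: measurable_patch.
apply: filterS2 (pairwise_aedisj_ae cF dF) (aesub_bigcup_ae cF FB).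
move=> x uniqx FBx _.
have [[Q [FQ Qx]]|nQ] := pselect (exists Q, F Q /\ Q x); last first.
  rewrite esum1 ?patch_ge0// => Q FQ; rewrite patchE memNset// => Qx.
  by apply: nQ; exists Q.
rewrite (@esum_single _ _ _ _ Q)//; [|exact: patch_ge0|].
  by rewrite !patchE !mem_set//; exact: FBx Qx.
move=> S FS SQ; rewrite patchE memNset// => Sx.
exact/SQ/uniqx.
Qed.

Lemma integral_le_esum B : measurable B -> aesub mu B (\bigcup_(Q in F) Q) ->
  (\int[mu]_(x in B) f x <= \esum_(Q in F) \int[mu]_(x in Q) f x)%E.
Proof.
move=> mB BF; rewrite integral_esum_patch [leLHS]integral_mkcond.
apply: ae_ge0_le_integral => //.
- by move=> x _; exact: patch_ge0.
- exact: measurable_patch.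
- by move=> x _; apply: esum_ge0 => Q _; exact: patch_ge0.
- exact: measurable_esum_patch.
apply: negligibleS BF => x /= /not_implyP[_ /negP].
rewrite -ltNge patchE; case: ifPn => [/set_mem Bx|_ H]; last first.
  exfalso; move: H; rewrite ltNge; move/negP; apply.
  by apply: esum_ge0 => Q _; exact: patch_ge0.
move=> H; split=> // -[Q FQ Qx]; move: H; rewrite ltNge => /negP; apply.
apply: le_trans (esum_sub (A := [set Q]) _ _).
- by rewrite esum_set1 ?patch_ge0// patchE mem_set.
- by move=> _ ->.
- by move=> ? _; exact: patch_ge0.
Qed.

End Families.

Lemma esum_measure_le F B : countable F -> (forall Q, F Q -> measurable Q) ->
  pairwise_aedisj F -> measurable B -> (forall Q, F Q -> aesub mu Q B) ->
  (\esum_(Q in F) mu Q <= mu B)%E.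
Proof.
move=> cF mF dF mB FB.
have := @esum_integral_le F (cst 1%E) cF mF (measurable_cst _) (fun=> lee01) B dF mB FB.
by under eq_esum => Q FQ do rewrite (integral_cst _ (mF _ FQ)) mul1e;
  rewrite integral_cst// mul1e.
Qed.

End NullRelations.

(** * Euclidean balls and Radon measures *)

Section Balls.
Context (R : realType) (d : nat).
Local Notation E := (borelRd R d).
Implicit Types (x y : 'rV[R]_d) (r : R).

Lemma open_measurableRd (U : set 'rV[R]_d) : open U -> measurable (U : set E).
Proof. by move=> oU; exact: sub_sigma_algebra. Qed.

Lemma edist_continuous x : continuous (Defs.edist x : 'rV[R]_d -> R).
Proof.
move=> y; apply: continuous_comp; last exact: sqrt_continuous.
pose D (s : seq 'I_d) (z : 'rV[R]_d) : R := \sum_(i <- s) (x ord0 i - z ord0 i) ^+ 2.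
suff H s : {for y, continuous (D s)} by exact: H.
elim: s => [|i s IHs].
  rewrite (_ : D [::] = cst 0); first exact: cst_continuous.
  by apply/funext => z; rewrite /D big_nil.
have xi : {for y, continuous (fun z : 'rV[R]_d => x ord0 i - z ord0 i)}.
  apply: (@continuousB _ R^o); first exact: cst_continuous.
  exact: (@coord_continuous R^o 1 d ord0 i y).
rewrite (_ : D (i :: s) = fun z =>
    (x ord0 i - z ord0 i) * (x ord0 i - z ord0 i) + D s z); last first.
  by apply/funext => z; rewrite /D big_cons expr2.
apply: (@continuousD _ R^o) => //; exact: (continuousM xi xi).
Qed.

Lemma eball_open x r : open (eball x r : set 'rV[R]_d).
Proof.
rewrite (_ : eball x r = Defs.edist x @^-1` [set s | s < r])//.
apply: open_comp => [y _|]; first exact: (@edist_continuous x).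
exact: open_lt.
Qed.

Lemma eball_measurable x r : measurable (eball x r).
Proof. by apply: open_measurableRd; exact: eball_open. Qed.

Lemma edist_coord x y (i : 'I_d) : `|x ord0 i - y ord0 i| <= Defs.edist x y.
Proof.
rewrite -sqrtr_sqr; apply: ler_wsqrtr; rewrite (bigD1 i)//= lerDl.
by apply: sumr_ge0 => j _; exact: sqr_ge0.
Qed.

Lemma edistxx x : Defs.edist x x = 0.
Proof.
by rewrite /Defs.edist big1 ?sqrtr0// => i _; rewrite subrr expr0n.
Qed.

Lemma eball_center x r : 0 < r -> eball x r x.
Proof. by rewrite /eball /= edistxx. Qed.

(** The topology of row vectors comes from the supremum metric; comparing with
    it coordinate by coordinate stands in for the Euclidean triangle
    inequality. *)
Lemma eball_ball z x y r : eball z r x -> eball z r y -> ball x (2 * r) y.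
Proof.
move=> zx zy; split.
  by rewrite mulr_gt0//; apply: le_lt_trans zx; exact: sqrtr_ge0.
move=> i j; rewrite /ball/= (ord1 i).
have := le_lt_trans (edist_coord z x j) zx.
have := le_lt_trans (edist_coord z y j) zy.
rewrite !ltr_norml => /andP[a b] /andP[a' b'].
by apply/andP; split; lra.
Qed.

Lemma eball_nbhs (U : set 'rV[R]_d) x : open U -> U x ->
  exists2 r, 0 < r & forall z, eball z r x -> eball z r `<=` U.
Proof.
move=> oU Ux; have /nbhs_ballP[e /= e0 eU] := open_nbhs_nbhs (conj oU Ux).
exists (e / 2); first by rewrite divr_gt0.
move=> z zx y zy; apply: eU; have := eball_ball zx zy.
by rewrite mulrC divfK.
Qed.

Lemma bigcup_eball x : \bigcup_n eball x n%:R = [set: E].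
Proof.
apply/seteqP; split=> // y _; exists (Num.bound (Defs.edist x y)) => //.
by rewrite /eball/=; apply: archi_boundP; exact: sqrtr_ge0.
Qed.

Context (mu : {measure set E -> \bar R}).

Lemma growth_fin_num n x r : polynomial_growth mu n -> (mu (eball x r) < +oo)%E.
Proof.
move=> gr; have [r0|r0] := ltP 0 r.
  by apply: le_lt_trans (gr _ _ r0) _; rewrite ltry.
rewrite (_ : eball x r = set0) ?measure0//.
apply/seteqP; split=> // y; rewrite /eball/= ltNge => /negP; apply.
exact: le_trans r0 (sqrtr_ge0 _).
Qed.

(** Away from the support every compact set is covered by finitely many null
    balls, so inner regularity of the open complement applies. *)
Lemma msupport_negligible : radon mu -> mu.-negligible (~` msupport mu).
Proof.
move=> [_ _ inner].
have nullball x : (~` msupport mu) x -> exists2 r, 0 < r & mu (eball x r) = 0%E.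
  move=> /existsNP[r /not_implyP[r0 /negP]]; rewrite -leNgt => m0.
  by exists r => //; apply/eqP; rewrite eq_le m0 measure_ge0.
have nullU x r : mu (eball x r) = 0%E -> eball x r `<=` ~` msupport mu.
  move=> m0 y xy sy.
  have [s s0 /(_ y (eball_center _ s0)) sU] := eball_nbhs (eball_open (r:=r)) xy.
  have := sy _ s0; apply/negP; rewrite -leNgt -m0.
  by apply: le_measure => //; rewrite inE; exact: eball_measurable.
have oU : open (~` msupport mu : set 'rV[R]_d).
  rewrite (congr1 (fun f : set (set 'rV[R]_d) => f (~` msupport mu))
    (@openE 'rV[R]_d)) /= => x /nullball[r r0 m0].
  apply: (filterS (nullU _ _ m0)); apply: open_nbhs_nbhs; split.
    exact: eball_open.
  exact: eball_center.
have mU := open_measurableRd oU.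
apply/(negligibleP mu mU); apply/eqP; rewrite eq_le measure_ge0 andbT.
apply: le_trans (_ : ereal_sup [set mu K | K in
    [set K : set 'rV[R]_d | compact K /\ K `<=` ~` msupport mu]] <= _)%E.
  by rewrite le_eqVlt; apply/orP; left; apply/eqP; exact: inner oU.
 apply: ge_ereal_sup => _ [K [cK KU] <-].
have /choice[rr rrP] : forall x : 'rV[R]_d, exists r,
    (~` msupport mu) x -> 0 < r /\ mu (eball x r) = 0%E.
  move=> x; have [/nullball[r r0 m0]|nx] := pselect ((~` msupport mu) x).
    by exists r.
  by exists 0.
move: (cK); rewrite compact_cover => /(_ _ (~` msupport mu) (fun x => eball x (rr x))).
case=> [x _|x Kx|D' D'U KD']; first exact: eball_open.
  by exists x; [exact: KU|apply: eball_center; have [] := rrP _ (KU _ Kx)].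
have mK : measurable (K : set E).
  rewrite -(setCK K); apply: measurableC; apply: open_measurableRd.
  by apply: closed_openC; apply: compact_closed => //; exact: norm_hausdorff.
have : mu.-negligible (K : set E).
  apply: (@negligibleS _ _ _ mu _ _ KD'); apply: negligible_countable_bigcup.
    by apply: finite_set_countable; exact: finite_fset.
  move=> x /= D'x; have [_ m0] := rrP _ (set_mem (D'U _ D'x)).
  by apply/negligibleP => //; exact: eball_measurable.
by move=> /(negligibleP mu mK) ->.
Qed.

End Balls.

(** * The tree of doubling cubes *)

Section DisjointFamilies.
Context (R : realType) (d : nat).
Local Notation E := (borelRd R d).
Variable mu : {measure set E -> \bar R}.

(** Inside a set of finite measure the masses of the members are summable, so
    only countably many of them are positive. *)
Lemma pairwise_aedisj_countable (F : set (set E)) (B : nat -> set E) :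
  (forall Q, F Q -> measurable Q) -> (forall Q, F Q -> ~ mu.-negligible Q) ->
  pairwise_aedisj mu F ->
  (forall m, measurable (B m)) -> (forall m, (mu (B m) < +oo)%E) ->
  \bigcup_m B m = setT -> countable F.
Proof.
move=> mF nF dF mB finB cB.
pose G m := [set Q | F Q /\ (0 < mu (Q `&` B m))%E].
have -> : F = \bigcup_m G m.
  apply/seteqP; split=> [Q FQ|Q [m _ []]//].
  apply: contrapT => nG; apply: (nF Q FQ).
  rewrite -(setIT Q) -cB setI_bigcupr; apply: negligible_bigcup => m.
  apply/negligibleP; first by apply: measurableI; [exact: mF|].
  apply/eqP; rewrite eq_le measure_ge0 andbT leNgt; apply/negP => pos.
  by apply: nG; exists m.
apply: bigcup_countable => // m _.
apply: (@esum_pos_countable R _ (G m) (fun Q => mu (Q `&` B m))) => [Q []//|].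
apply: le_lt_trans (finB m); apply: ge_ereal_sup => _ [X [finX XG] <-].
have XF Q : X Q -> F Q by move=> /XG[].
have mX Q : X Q -> measurable Q by move=> /XF/mF.
have mf : measurable_fun setT (EFin \o (\1_(B m) : E -> R)).
  by apply/measurable_EFinP; exact: measurable_indic.
have f0 x : (0 <= (EFin \o (\1_(B m) : E -> R)) x)%E by rewrite lee_fin.
have dX : pairwise_aedisj mu X by move=> P S /XF FP /XF FS; exact: dF.
have XT Q : X Q -> aesub mu Q setT by move=> _; exact: subset_aesub.
have := esum_integral_le (finite_set_countable finX) mX mf f0 dX measurableT XT.
rewrite integral_indic// setIT; apply: le_trans.
rewrite -esum_fset//; apply: le_esum => Q XQ.
by rewrite integral_indic ?(setIC (B m))//; exact: mX.
Qed.

End DisjointFamilies.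

Section CubeTree.
Context (R : realType) (d : nat) (n : R).
Local Notation E := (borelRd R d).
Variables (mu : {measure set E -> \bar R}) (A : R) (D : int -> set (set E)).
Variables (cen : int -> set E -> 'rV[R]_d) (rad : int -> set E -> R).
Hypothesis mu_growth : polynomial_growth mu n.
Hypothesis dm : david_mattila mu D cen rad A.
Local Notation aesub := (aesub mu).
Local Notation aedisj := (aedisj mu).
Local Notation aeproper := (aeproper mu).
Local Notation cubes := (cubes D).
Local Notation doubling := (doubling_cubes mu D cen rad).
Local Notation parent := (smallest_doubling_above mu D cen rad).
Local Notation ancestor := (sigma_ancestor mu D cen rad).
Implicit Types (P Q S T : set E) (k l q : int).

Lemma cube_gen k Q : D k Q -> cubes Q.
Proof. by exists k. Qed.

Lemma doubling_cube Q : doubling Q -> cubes Q.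
Proof. by move=> [k DQ _]; exists k. Qed.

Lemma cube_measurable Q : cubes Q -> measurable Q.
Proof. exact: (dm_measurable dm). Qed.

Lemma ratio_gt2 : 2 < A.
Proof.
have [bA _] := dm_ratio dm; apply: le_lt_trans bA.
apply: (@le_trans _ _ (alpha R)); first by rewrite /alpha; lra.
by rewrite /beta exprS ler_peMr ?exprn_ege1// /alpha; lra.
Qed.

Lemma ratio_gt0 : 0 < A.
Proof. exact: lt_trans ratio_gt2. Qed.

Lemma rad_gt0 k Q : D k Q -> 0 < rad k Q.
Proof.
have [c c0 cP] := dm_radius dm; move=> /cP[+ _]; apply: lt_le_trans.
by rewrite mulr_gt0 ?invr_gt0// exprz_gt0// ratio_gt0.
Qed.

Lemma cube_finite Q : cubes Q -> (mu Q < +oo)%E.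
Proof.
move=> cQ; have [k _ DQ] := cQ; have [_ Qb] := dm_ball dm DQ.
apply: le_lt_trans (growth_fin_num (cen k Q) (28 * rad k Q) mu_growth).
by apply: ae_le_measure Qb; [exact: cube_measurable|exact: eball_measurable].
Qed.

Lemma cube_positive Q : cubes Q -> (0 < mu Q)%E.
Proof.
move=> cQ; have [k _ DQ] := cQ; have [bQ _] := dm_ball dm DQ.
apply: lt_le_trans (dm_center dm DQ (rad_gt0 DQ)) _.
by apply: ae_le_measure bQ; [exact: eball_measurable|exact: cube_measurable].
Qed.

Lemma cube_not_negligible Q : cubes Q -> ~ mu.-negligible Q.
Proof.
move=> cQ; have mQ := cube_measurable cQ.
by move=> /(negligibleP mu mQ) Q0; have := cube_positive cQ; rewrite Q0 ltxx.
Qed.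

Lemma cube_not_aedisj P Q S : cubes P -> aesub P Q -> aesub P S -> ~ aedisj Q S.
Proof.
move=> cP PQ PS QS; apply: (cube_not_negligible cP).
by rewrite -(setIid P); exact: aedisjS QS.
Qed.

Lemma cube_eq Q S : cubes Q -> cubes S -> aesub Q S -> aesub S Q -> Q = S.
Proof. by move=> cQ cS QS SQ; exact: (dm_identified dm). Qed.

Lemma aeproperE Q S : cubes Q -> cubes S ->
  aeproper Q S <-> aesub Q S /\ Q <> S.
Proof.
move=> cQ cS; split=> -[QS H]; split=> //.
  by move=> QSe; apply: H; rewrite QSe; exact: aesub_refl.
by move=> SQ; apply: H; exact: cube_eq.
Qed.

Lemma countable_generation k : countable (D k).
Proof.
apply: (@pairwise_aedisj_countable _ _ mu _ (fun m => eball 0 m%:R)).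
- by move=> Q DQ; apply: cube_measurable; exact: cube_gen DQ.
- by move=> Q DQ; apply: cube_not_negligible; exact: cube_gen DQ.
- by move=> P S; exact: (dm_disjoint dm).
- by move=> m; exact: eball_measurable.
- by move=> m; exact: growth_fin_num mu_growth.
- exact: bigcup_eball.
Qed.

Lemma countable_cubes : countable cubes.
Proof.
by apply: bigcup_countable => // k _; exact: countable_generation.
Qed.

Lemma same_generation k Q S : D k Q -> D k S -> ~ aedisj Q S -> Q = S.
Proof. by move=> DQ DS H; apply: contrapT => /(dm_disjoint dm DQ DS). Qed.

Lemma refine_le k l Q : k <= l -> D l Q -> exists2 S, D k S & aesub Q S.
Proof.
move=> kl; have -> : l = k + `|l - k|%N%:Z by lia.
elim: `|l - k|%N Q => [|m IHm] Q.
  by rewrite addr0 => DQ; exists Q => //; exact: aesub_refl.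
rewrite (_ : k + m.+1%:Z = k + m%:Z + 1); last by lia.
move=> /(dm_refine dm)[S /IHm[S' DS' SS'] QS]; exists S' => //.
exact: aesub_trans SS'.
Qed.

(** Q is contained in some cube of the generation of S, which overlaps S and is
    therefore S. *)
Lemma coarser_contains k l Q S : k <= l -> D l Q -> D k S -> ~ aedisj Q S ->
  aesub Q S.
Proof.
move=> kl DQ DS QS; have [S' DS' QS'] := refine_le kl DQ.
rewrite (@same_generation k S S')// => SS'; apply: QS.
exact: aedisjS QS' (aesub_refl _ _) (aedisj_sym SS').
Qed.

Lemma proper_generation k l Q S : D l Q -> D k S -> aeproper Q S -> k < l.
Proof.
move=> DQ DS [QS SQ]; rewrite ltNge; apply/negP => lk; apply: SQ.
apply: (coarser_contains lk DS DQ) => /aedisj_sym.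
by apply: cube_not_aedisj (cube_gen DQ) (aesub_refl _ _) QS.
Qed.

(** Among the doubling cubes properly above Q, take one of finest generation:
    the others overlap it and are coarser, so they contain it. *)
Lemma parent_exists Q S : doubling Q -> doubling S -> aeproper Q S ->
  exists P, parent Q P.
Proof.
move=> dQ dS QS; have [q DQ _] := dQ; have [k DS _] := dS.
pose above (m : nat) := asbool (exists T, [/\ doubling T, aeproper Q T & D (q - m%:Z) T]).
have [|m /asboolP[T [dT QT DT]] minm] := @ex_minnP above.
  exists `|q - k|%N; apply/asboolP; exists S; split=> //.
  have kq := proper_generation DQ DS QS.
  by rewrite (_ : q - _ = k)//; lia.
exists T; split=> // S' dS' QS'; have [l DS' _] := dS'.
have lq := proper_generation DQ DS' QS'.
have ml : (m <= `|q - l|)%N.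
  apply: minm; apply/asboolP; exists S'; split=> //.
  by rewrite (_ : q - _ = l)//; lia.
apply: (coarser_contains _ DT DS'); first by lia.
by apply: cube_not_aedisj (cube_gen DQ) _ _; [case: QT|case: QS'].
Qed.

Lemma parent_unique Q P P' : parent Q P -> parent Q P' -> P = P'.
Proof.
move=> [dP QP minP] [dP' QP' minP'].
by apply: cube_eq; [exact: doubling_cube|exact: doubling_cube|exact: minP|exact: minP'].
Qed.

(** By nestedness, both sides say that no doubling cube lies strictly between P
    and Q. *)
Lemma child_parent Q P : doubling Q ->
  maximal_doubling_below mu D cen rad Q P <-> doubling P /\ parent P Q.
Proof.
move=> dQ; split=> [[dP PQ maxP]|[dP [_ PQ minQ]]]; split=> //.
  split=> // S dS PS.
  have [//|SQ|] := dm_nested dm (doubling_cube dQ) (doubling_cube dS); last first.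
    move=> QS; exfalso; apply: cube_not_aedisj QS; first exact: doubling_cube dP.
      by case: PQ.
    by case: PS.
  by apply: contrapT => nQS; exact: (maxP S dS).
move=> S dS [SQ nSQ] PS; apply: nSQ; exact: minQ.
Qed.

Lemma ancestor_doubling Q j P : doubling Q -> ancestor Q j P -> doubling P.
Proof. by move=> dQ; elim=> [//|m S T _ _ []]. Qed.

Lemma ancestor_aesub Q j P : ancestor Q j P -> aesub Q P.
Proof.
elim=> [|m S T _ QS [_ [ST _] _]]; first exact: aesub_refl.
exact: aesub_trans ST.
Qed.

Lemma ancestor_proper Q j P : ancestor Q j.+1 P -> ~ aesub P Q.
Proof.
move=> QP PQ; inversion QP as [|j' S P' QS [_ [_ nPS] _]]; subst.
by apply: nPS; apply: aesub_trans PQ (ancestor_aesub QS).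
Qed.

Lemma ancestor_trans Q a P b S : ancestor Q a P -> ancestor P b S ->
  ancestor Q (a + b) S.
Proof.
move=> QP; elim=> [|j T T' _ IH TT']; first by rewrite addn0.
by rewrite addnS; exact: sigma_ancestorS TT'.
Qed.

Lemma ancestor_split Q a b P S : ancestor Q a P -> ancestor Q (a + b) S ->
  ancestor P b S.
Proof.
move=> QP; elim: b S => [|b IH] S.
  rewrite addn0 => QS; suff -> : S = P by exact: sigma_ancestor0.
  elim: QP S QS => [|j T T' _ IH TT'] S QS; first by inversion QS.
  inversion QS as [|j' U U' QU US]; subst.
  by move: US; rewrite (IH _ QU) => US; exact: parent_unique TT'.
rewrite addnS => QS; inversion QS as [|j' U U' QU US]; subst.
by apply: sigma_ancestorS US; exact: IH.
Qed.

Lemma ancestor_inj Q a b P : ancestor Q a P -> ancestor Q b P -> a = b.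
Proof.
wlog ab : a b / (a <= b)%N => [H Qa Qb|Qa].
  by have [/H|/ltnW/H] := leqP a b; [exact|move=> /(_ Qb Qa)].
rewrite -(subnKC ab); case: (b - a)%N => [|t]; first by rewrite addn0.
by move=> /(ancestor_split Qa)/ancestor_proper; have := aesub_refl mu P.
Qed.

(** Successive parents of Q have strictly decreasing generations, bounded below
    by the generation of S; so the chain reaches S. *)
Lemma ancestor_exists Q S : doubling Q -> doubling S -> aesub Q S ->
  exists j, ancestor Q j S.
Proof.
move=> dQ dS + ; have [q DQ _] := dQ; have [k DS _] := dS.
have [N] : exists N : nat, q - k <= N%:Z by exists `|q - k|%N; lia.
elim: N Q q dQ DQ => [|m IH] Q q dQ DQ qk QS.
  exists 0%N; suff -> : S = Q by exact: sigma_ancestor0.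
  apply: contrapT => nQS; have QSp : aeproper Q S.
    apply/aeproperE; [exact: doubling_cube|exact: doubling_cube|].
    by split=> // QSe; exact: nQS.
  have := proper_generation DQ DS QSp; lia.
have [->|nQS] := pselect (S = Q); first by exists 0%N; exact: sigma_ancestor0.
have QSp : aeproper Q S.
  apply/aeproperE; [exact: doubling_cube|exact: doubling_cube|].
  by split=> // QSe; exact: nQS.
have [P QP] := parent_exists dQ dS QSp.
have [dP QPp minP] := QP; have [l DP _] := dP.
have lq := proper_generation DQ DP QPp.
have [|j PS] := IH P l dP DP _ (minP S dS QSp); first by lia.
exists (1 + j)%N; apply: ancestor_trans PS.
by apply: sigma_ancestorS QP; exact: sigma_ancestor0.
Qed.

Lemma cube_support Q : cubes Q -> aesub Q (msupport mu).
Proof.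
move=> [k _ DQ]; have [cover _] := dm_cover dm k.
by apply: aesub_trans cover; apply: subset_aesub => x Qx; exists Q.
Qed.

(** Otherwise S would be disjoint from the countable union of the cubes above Q,
    which exhausts the support. *)
Lemma exhaust_meets Q S : cubes Q -> cubes S ->
  exists T, [/\ cubes T, aesub Q T & ~ aedisj S T].
Proof.
move=> cQ cS; apply: contrapT => H; apply: (cube_not_negligible cS).
have ctF : countable [set T | cubes T /\ aesub Q T].
  by apply: sub_countable countable_cubes; apply: subset_card_le => T [].
have N : mu.-negligible (\bigcup_(T in [set T | cubes T /\ aesub Q T]) (S `&` T)).
  apply: negligible_countable_bigcup => // T [cT QT].
  by apply: contrapT => ST; apply: H; exists T.
have N' := aesub_trans (cube_support cS) (dm_exhaust dm cQ).
apply: (negligibleS _ (negligibleU N N')).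
move=> x Sx; have [[T TQ Tx]|nx] := pselect ((\bigcup_(T in [set T | cubes T /\ aesub Q T]) T) x).
  by left; exists T.
by right.
Qed.

Lemma doubling_common Q S : doubling Q -> doubling S ->
  exists T, [/\ doubling T, aesub Q T & aesub S T].
Proof.
move=> dQ dS.
have [T [cT QT ST]] := exhaust_meets (doubling_cube dQ) (doubling_cube dS).
have [ST'|TS|//] := dm_nested dm (doubling_cube dS) cT.
  have [U dU TU] := dm_doubling_above dm cT.
  by exists U; split=> //; exact: aesub_trans TU.
by exists S; split=> //; [exact: aesub_trans TS|exact: aesub_refl].
Qed.

End CubeTree.

(** * Levels of the filtration *)

Section Levels.
Context (R : realType) (d : nat) (n : R).
Local Notation E := (borelRd R d).
Variables (mu : {measure set E -> \bar R}) (A : R) (D : int -> set (set E)).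
Variables (cen : int -> set E -> 'rV[R]_d) (rad : int -> set E -> R).
Hypothesis mu_growth : polynomial_growth mu n.
Hypothesis dm : david_mattila mu D cen rad A.
Variable Q0 : set E.
Hypothesis dQ0 : doubling_cubes mu D cen rad Q0.
Local Notation aesub := (aesub mu).
Local Notation aedisj := (aedisj mu).
Local Notation doubling := (doubling_cubes mu D cen rad).
Local Notation parent := (smallest_doubling_above mu D cen rad).
Local Notation ancestor := (sigma_ancestor mu D cen rad).
Local Notation Pi := (sigma_atoms mu D cen rad Q0).
Implicit Types (P Q S T : set E) (k l q : int).

(** The level of Q read off from any common ancestor of Q and Q0; this form
    makes its uniqueness visible. *)
Definition level k Q :=
  exists a b P, [/\ ancestor Q a P, ancestor Q0 b P & k = a%:Z - b%:Z].

Lemma level_unique k l Q : level k Q -> level l Q -> k = l.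
Proof.
move=> [a [b [P [QP Q0P ->]]]] [a' [b' [P' [QP' Q0P' ->]]]].
wlog aa : a b P QP Q0P a' b' P' QP' Q0P' / (a <= a')%N => [H|].
  have [aa|/ltnW aa] := leqP a a'.
    exact: (H a b P QP Q0P a' b' P' QP' Q0P' aa).
  by apply/esym; exact: (H a' b' P' QP' Q0P' a b P QP Q0P aa).
have bb : b' = (b + (a' - a))%N.
  apply: (ancestor_inj dm Q0P'); apply: ancestor_trans Q0P _.
  by apply: (ancestor_split dm QP); rewrite subnKC.
lia.
Qed.

Lemma atom_doubling k Q : Pi k Q -> doubling Q.
Proof.
elim=> [j P|l P S _ dP /(child_parent dm _ dP)[]//].
exact: ancestor_doubling.
Qed.

Lemma atom_level k Q : Pi k Q -> level k Q.
Proof.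
elim=> [j P Q0P|l P S PiP [a [b [T [PT Q0T ->]]]] PS].
  by exists 0%N, j, P; split; [exact: sigma_ancestor0|exact: Q0P|rewrite sub0r].
have [dS SP] := (child_parent dm _ (atom_doubling PiP)).1 PS.
exists (1 + a)%N, b, T; split=> //; last by lia.
apply: ancestor_trans PT; apply: sigma_ancestorS SP; exact: sigma_ancestor0.
Qed.

Lemma atom_descend Q a T k : doubling Q -> ancestor Q a T -> Pi k T ->
  Pi (k + a%:Z) Q.
Proof.
move=> dQ QT; elim: QT k => [|j P S QP IH PS] k; first by rewrite addr0.
move=> PiS; rewrite (_ : k + j.+1%:Z = k + 1 + j%:Z); last by lia.
apply: IH; apply: sigma_atoms_child PiS _.
have dS : doubling S by case: PS.
apply/(child_parent dm _ dS); split=> //; exact: ancestor_doubling QP.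
Qed.

(** Q and Q0 have a common ancestor; it is an atom as an ancestor of Q0, and Q is
    reached from it by passing to children. *)
Lemma doubling_atom Q : doubling Q -> exists k, Pi k Q.
Proof.
move=> dQ; have [T [dT QT Q0T]] := doubling_common mu_growth dm dQ dQ0.
have [a QaT] := ancestor_exists dm dQ dT QT.
have [b Q0bT] := ancestor_exists dm dQ0 dT Q0T.
by exists (- b%:Z + a%:Z); apply: atom_descend QaT _ => //; exact: sigma_atoms_ancestor.
Qed.

Lemma atom_unique k l Q : Pi k Q -> Pi l Q -> k = l.
Proof. by move=> /atom_level Lk /atom_level; exact: level_unique. Qed.

(** Q is reached from S by some number of descents, each of which raises the
    level. *)
Lemma atom_eq k Q S : Pi k Q -> Pi k S -> aesub Q S -> Q = S.
Proof.
move=> PQ PS QS; have dQ := atom_doubling PQ; have dS := atom_doubling PS.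
have [m QmS] := ancestor_exists dm dQ dS QS.
have := atom_unique PQ (atom_descend dQ QmS PS).
case: m QmS => [QS0 _|m _]; last by lia.
by inversion QS0.
Qed.

Lemma atom_disjoint k Q S : Pi k Q -> Pi k S -> Q <> S -> aedisj Q S.
Proof.
move=> PQ PS QS.
have [H|H|//] := dm_nested dm (doubling_cube (atom_doubling PQ))
  (doubling_cube (atom_doubling PS)); first by case: QS; exact: (atom_eq PQ PS H).
by case: QS; apply/esym; exact: (atom_eq PS PQ H).
Qed.

Lemma atom_parent k Q P : Pi k Q -> parent Q P -> Pi (k - 1) P.
Proof.
move=> PQ QP; have [dP _ _] := QP; have [l PP] := doubling_atom dP.
have : Pi (l + 1) Q.
  apply: sigma_atoms_child PP _; apply/(child_parent dm _ dP).
  by split=> //; exact: atom_doubling PQ.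
by move=> /(atom_unique PQ) ->; rewrite addrK.
Qed.

End Levels.

(** * Stopping cubes *)

Section LargeCubes.
Context (R : realType) (d : nat) (n : R).
Local Notation E := (borelRd R d).
Variables (mu : {measure set E -> \bar R}) (A : R) (D : int -> set (set E)).
Variables (cen : int -> set E -> 'rV[R]_d) (rad : int -> set E -> R).
Hypotheses (mu_radon : radon mu) (mu_growth : polynomial_growth mu n).
Hypothesis dm : david_mattila mu D cen rad A.
Local Notation aesub := (aesub mu).
Local Notation doubling := (doubling_cubes mu D cen rad).
Implicit Types (P Q S T : set E) (k l q : int).

(** The doubling cubes above Q are totally ordered and exhaust the support, so
    their masses tend to the total mass. *)
Lemma doubling_above_mass Q (c : R) : doubling Q ->
  ((mu setT < +oo)%E -> c < fine (mu setT)) ->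
  exists S, [/\ doubling S, aesub Q S & (c%:E <= mu S)%E].
Proof.
move=> dQ Hc; apply: contrapT => H.
have small S : doubling S -> aesub Q S -> (mu S <= c%:E)%E.
  by move=> dS QS; rewrite leNgt; apply/negP => /ltW cS; apply: H; exists S.
suff muc : (mu setT <= c%:E)%E.
  have fin := le_lt_trans muc (ltry c); have := Hc fin.
  rewrite -lte_fin fineK; last by rewrite ge0_fin_numE.
  by rewrite ltNge muc.
pose F := [set S | doubling S /\ aesub Q S].
have cF : countable F.
  apply: sub_countable (countable_cubes mu_growth dm).
  by apply: subset_card_le => S [/doubling_cube].
have [F0|[B [e [eF _ Fe]]]] := countable_enumeration cF.
  by have : F Q; [split=> //; exact: aesub_refl|rewrite F0].
pose G m := if m \in B then e m else Q.
have FG m : F (G m).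
  by rewrite /G; case: ifPn => [/set_mem/eF//|_]; split=> //; exact: aesub_refl.
have GF S : F S -> exists m, S = G m.
  by move=> /Fe[m Bm <-]; exists m; rewrite /G mem_set.
have mG m : measurable (G m).
  by have [/doubling_cube + _] := FG m; exact: (cube_measurable dm).
pose U m := \big[setU/set0]_(i < m) G i.
have mU m : measurable (U m) by exact: bigsetU_measurable.
have Usub m : exists2 S, F S & aesub (U m) S.
  elim: m => [|m [S [dS QS] US]].
    exists Q; first by split=> //; exact: aesub_refl.
    by rewrite /U big_ord0; exact: subset_aesub.
  have [dG QG] := FG m.
  have join T : aesub S T -> aesub (G m) T -> aesub (U m.+1) T.
    move=> ST GT; rewrite /U big_ord_recr/=.
    apply: (negligibleS _ (negligibleU (aesub_trans US ST) GT)).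
    by move=> x [[Ux|Gx] Tx]; [left|right].
  have [SG|GS|SG] := dm_nested dm (doubling_cube dS) (doubling_cube dG).
  - by exists (G m) => //; apply: join => //; exact: aesub_refl.
  - by exists S => //; apply: join => //; exact: aesub_refl.
  - by have := cube_not_aedisj dm (doubling_cube dQ) QS QG.
have Uc m : (mu (U m) <= c%:E)%E.
  have [S [dS QS] US] := Usub m; apply: le_trans (small S dS QS).
  apply: ae_le_measure => //; exact: (cube_measurable dm (doubling_cube dS)).
have UT : aesub setT (\bigcup_m U m).
  have nsupp : aesub setT (msupport mu).
    by rewrite /Defs.aesub setTD; exact: msupport_negligible.
  apply: (aesub_trans nsupp).
  apply: (aesub_trans (dm_exhaust dm (doubling_cube dQ))).
  apply: aesub_bigcup => [|S [cS QS]].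
    apply: sub_countable (countable_cubes mu_growth dm).
    by apply: subset_card_le => S [].
  have [T dT ST] := dm_doubling_above dm cS.
  apply: (aesub_trans ST); have [|m ->] := GF T.
    by split=> //; exact: aesub_trans ST.
  apply: subset_aesub => x Gx; exists m.+1 => //.
  by rewrite /U big_ord_recr/=; right.
have mUU : measurable (\bigcup_m U m) by exact: bigcup_measurable.
apply: le_trans (ae_le_measure measurableT mUU UT) _.
have ndU : {homo U : m k / (m <= k)%N >-> (m <= k)%O}.
  by move=> m k mk; apply/subsetPset; exact: subset_bigsetU.
have cvgU := nondecreasing_cvg_mu (mu := mu) mU mUU ndU.
rewrite -(cvg_lim _ cvgU)//; apply: lime_le; first by apply/cvg_ex; exists (mu (\bigcup_m U m)).
by apply: nearW.
Qed.

End LargeCubes.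

Section Stopping.
Context (R : realType) (d : nat) (n : R).
Local Notation E := (borelRd R d).
Variables (mu : {measure set E -> \bar R}) (A : R) (D : int -> set (set E)).
Variables (cen : int -> set E -> 'rV[R]_d) (rad : int -> set E -> R).
Hypotheses (mu_radon : radon mu) (mu_growth : polynomial_growth mu n).
Hypothesis dm : david_mattila mu D cen rad A.
Variable Q0 : set E.
Hypothesis dQ0 : doubling_cubes mu D cen rad Q0.
Local Notation aesub := (aesub mu).
Local Notation aeproper := (aeproper mu).
Local Notation cubes := (cubes D).
Local Notation doubling := (doubling_cubes mu D cen rad).
Local Notation parent := (smallest_doubling_above mu D cen rad).
Local Notation Pi := (sigma_atoms mu D cen rad Q0).
Variables (f : E -> R) (lambda : R).
Hypotheses (f0 : forall x, 0 <= f x) (intf : mu.-integrable setT (EFin \o f)).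
Hypothesis lambda0 : 0 < lambda.
Hypothesis lambda_large : (mu setT < +oo)%E ->
  fine (\int[mu]_x (f x)%:E) / fine (mu setT) < lambda.
Local Notation maximal := (maximal_cube mu Pi f lambda).
Implicit Types (P Q S T : set E) (k l q : int).

Let mf : measurable_fun setT (EFin \o f).
Proof. exact: measurable_int intf. Qed.

Let Ef0 x : (0 <= (EFin \o f) x)%E.
Proof. by rewrite lee_fin. Qed.

Lemma total_fin_num : (\int[mu]_x (f x)%:E)%E \is a fin_num.
Proof. exact: integrable_fin_num intf. Qed.

Lemma integral_le_total B : measurable B ->
  (\int[mu]_(x in B) (f x)%:E <= \int[mu]_x (f x)%:E)%E.
Proof.
by move=> mB; exact: (ae_le_integral mB measurableT mf Ef0 (subset_aesub mu (@subsetT _ B))).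
Qed.

Lemma integral_fin_num B : measurable B ->
  (\int[mu]_(x in B) (f x)%:E)%E \is a fin_num.
Proof.
move=> mB; rewrite ge0_fin_numE; last by apply: integral_ge0 => x _; exact: Ef0.
apply: le_lt_trans (integral_le_total mB) _.
by rewrite -ge0_fin_numE ?total_fin_num//; apply: integral_ge0 => x _; exact: Ef0.
Qed.

Lemma avg_le (c : R) Q : cubes Q ->
  avg mu f Q <= c <-> (\int[mu]_(x in Q) (f x)%:E <= c%:E * mu Q)%E.
Proof.
move=> cQ; have mQ := cube_measurable dm cQ.
have Qfin : mu Q \is a fin_num by rewrite ge0_fin_numE// (cube_finite mu_growth dm).
have Q_gt0 : 0 < fine (mu Q).
  by rewrite fine_gt0// (cube_positive dm cQ) -ge0_fin_numE.
rewrite -[X in (_ <= _ * X)%E]fineK// -(fineK (integral_fin_num mQ)) -EFinM lee_fin.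
by rewrite /avg /Rintegral mulrC ler_pdivrMr.
Qed.

(** The average of f over T is at most the norm of f divided by the mass of T,
    and the mass of large cubes comes close to the total mass. *)
Lemma large_cube Q : doubling Q -> exists S, [/\ doubling S, aesub Q S &
  forall T, doubling T -> aesub S T -> avg mu f T <= lambda].
Proof.
move=> dQ; pose I := fine (\int[mu]_x (f x)%:E).
have [|S [dS QS IS]] := @doubling_above_mass R d n mu A D cen rad mu_radon
    mu_growth dm Q (I / lambda) dQ.
  move=> fin; have := lambda_large fin.
  have muT : 0 < fine (mu setT).
    rewrite fine_gt0// fin andbT; apply: lt_le_trans (cube_positive dm (doubling_cube dQ)) _.
    apply: le_measure; rewrite ?inE//; exact: (cube_measurable dm (doubling_cube dQ)).
  by rewrite ltr_pdivrMr// mulrC -ltr_pdivrMr.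
exists S; split=> // T dT ST; apply/(avg_le lambda (doubling_cube dT)).
have mT := cube_measurable dm (doubling_cube dT).
have mS := cube_measurable dm (doubling_cube dS).
apply: le_trans (integral_le_total mT) _; rewrite -(fineK total_fin_num).
rewrite -/I -[leLHS](_ : (lambda * (I / lambda))%:E = _)%E; last first.
  by rewrite mulrC divfK// gt_eqF.
rewrite EFinM; apply: lee_wpmul2l; first by rewrite lee_fin ltW.
apply: le_trans IS _; exact: (ae_le_measure mS mT ST).
Qed.

Lemma maximal_doubling Q : maximal Q -> doubling Q.
Proof. by move=> [[k PQ] _ _]; exact: (atom_doubling dm dQ0 PQ). Qed.

Lemma maximal_not_proper Q S : maximal Q -> doubling S -> lambda < avg mu f S ->
  ~ aeproper Q S.
Proof.
move=> [_ _ maxQ] dS; have [k PS] := doubling_atom mu_growth dm dQ0 dS.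
exact: maxQ PS.
Qed.

(** Take the coarsest generation that contains such a cube above Q; it exists
    because all cubes above a large cube have small averages. *)
Lemma maximal_above Q : doubling Q -> lambda < avg mu f Q ->
  exists2 P, maximal P & aesub Q P.
Proof.
move=> dQ avgQ; have [S0 [dS0 QS0 S0large]] := large_cube dQ.
have [q DQ _] := dQ; have [k0 DS0 _] := dS0.
pose stop (m : nat) := asbool (exists T,
  [/\ D (k0 + m%:Z) T, doubling T, aesub Q T & lambda < avg mu f T]).
have [|m /asboolP[T [DT dT QT avgT]] minm] := @ex_minnP stop.
  have QS0p : aeproper Q S0.
    apply/(aeproperE dm (doubling_cube dQ) (doubling_cube dS0)); split=> // QE.
    by have := S0large _ dS0 (aesub_refl _ _); rewrite -QE leNgt avgQ.
  have k0q := proper_generation dm DQ DS0 QS0p.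
  exists `|q - k0|%N; apply/asboolP; exists Q; split=> //; last exact: aesub_refl.
  by rewrite (_ : k0 + _ = q)//; lia.
exists T => //; split=> //; first exact: (doubling_atom mu_growth dm).
move=> k S PS avgS TS; have dS := atom_doubling dm dQ0 PS.
have [l DS _] := dS; have lm := proper_generation dm DT DS TS.
have QS : aesub Q S by apply: aesub_trans QT _; case: TS.
have [lk0|k0l] := ltP l k0.
  have S0S : aesub S0 S.
    apply: (coarser_contains dm (ltW lk0) DS0 DS).
    exact: (cube_not_aedisj dm (doubling_cube dQ)).
  by have := S0large _ dS S0S; rewrite leNgt avgS.
have ml : (m <= `|l - k0|)%N.
  apply: minm; apply/asboolP; exists S; split=> //.
  by rewrite (_ : k0 + _ = l)//; lia.
lia.
Qed.

Lemma maximal_parent Q : maximal Q ->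
  exists2 P, parent Q P & avg mu f P <= lambda.
Proof.
move=> maxQ; have dQ := maximal_doubling maxQ.
have [S [dS QS Slarge]] := large_cube dQ.
have QSp : aeproper Q S.
  apply/(aeproperE dm (doubling_cube dQ) (doubling_cube dS)); split=> // QE.
  have [_ + _] := maxQ; rewrite QE ltNge; apply/negP; rewrite negbK.
  exact: (Slarge _ dS (aesub_refl _ _)).
have [P QP] := parent_exists dm dQ dS QSp; exists P => //.
rewrite leNgt; apply/negP => avgP; have [dP QPp _] := QP.
exact: (maximal_not_proper maxQ dP avgP).
Qed.

Lemma maximal_disjoint : pairwise_aedisj mu maximal.
Proof.
move=> Q S maxQ maxS QS.
have dQ := maximal_doubling maxQ; have dS := maximal_doubling maxS.
have [H|H|//] := dm_nested dm (doubling_cube dQ) (doubling_cube dS).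
  exfalso; apply: (maximal_not_proper maxQ dS); first by case: maxS.
  by apply/(aeproperE dm (doubling_cube dQ) (doubling_cube dS)).
exfalso; apply: (maximal_not_proper maxS dQ); first by case: maxQ.
by apply/(aeproperE dm (doubling_cube dS) (doubling_cube dQ)); split=> // /esym.
Qed.

Lemma countable_maximal : countable [set Q | maximal Q].
Proof.
apply: sub_countable (countable_cubes mu_growth dm).
by apply: subset_card_le => Q /maximal_doubling/doubling_cube.
Qed.

Lemma maximal_measurable Q : maximal Q -> measurable Q.
Proof.
by move=> maxQ; exact: (cube_measurable dm (doubling_cube (maximal_doubling maxQ))).
Qed.

Definition unstopped : set E := ~` \bigcup_(Q in [set Q | maximal Q]) Q.

Lemma unstopped_measurable : measurable unstopped.
Proof.
apply: measurableC; have [->|[B [e [eM _ Me]]]] := countable_enumeration countable_maximal.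
  by rewrite bigcup_set0.
rewrite (_ : \bigcup_(Q in _) Q = \bigcup_(m in B) e m).
  by apply: bigcup_measurable => m Bm; apply: maximal_measurable; exact: (eM m Bm).
apply/seteqP; split=> x [].
  by move=> Q /Me[m Bm <-] Qx; exists m.
by move=> m Bm ex; exists (e m) => //; exact: eM.
Qed.

(** A doubling cube of average above lambda lies in a maximal one, so only
    doubling cubes of average at most lambda meet the unstopped set; a general
    cube is a disjoint union of doubling ones. *)
Lemma cube_unstopped Q : cubes Q ->
  (\int[mu]_(x in Q) ((EFin \o f) \_ unstopped) x <= lambda%:E * mu Q)%E.
Proof.
have mG := unstopped_measurable.
have mfG : measurable_fun setT ((EFin \o f) \_ unstopped) by exact: measurable_patch.
have fG0 x : (0 <= ((EFin \o f) \_ unstopped) x)%E by exact: patch_ge0.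
have dbl P : doubling P ->
    (\int[mu]_(x in P) ((EFin \o f) \_ unstopped) x <= lambda%:E * mu P)%E.
  move=> dP; have mP := cube_measurable dm (doubling_cube dP).
  have mPG := measurableI _ _ mP mG.
  rewrite -integral_mkcondr; have [avgP|avgP] := leP (avg mu f P) lambda.
    apply: le_trans ((avg_le _ (doubling_cube dP)).1 avgP).
    apply: ae_le_integral => //; apply: subset_aesub; exact: subIsetl.
  have [S maxS PS] := maximal_above dP avgP.
  apply: (@le_trans _ _ 0%E); last first.
    by rewrite mule_ge0// lee_fin ltW.
  rewrite -(integral_set0 mu (EFin \o f)); apply: ae_le_integral => //.
  rewrite /Defs.aesub setD0; apply: negligibleS PS => x [Px nx]; split=> // Sx.
  by apply: nx; exists S.
move=> cQ; have mQ := cube_measurable dm cQ.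
have [F [Fdbl Fdisj [QF FQ]]] := dm_doubling_partition dm cQ.
have cF : countable F.
  apply: sub_countable (countable_cubes mu_growth dm).
  by apply: subset_card_le => P /Fdbl/doubling_cube.
have mF P : F P -> measurable P by move=> /Fdbl/doubling_cube/(cube_measurable dm).
apply: le_trans (integral_le_esum cF mF mfG fG0 mQ QF) _.
apply: (@le_trans _ _ (\esum_(P in F) (lambda%:E * mu P))%E).
  by apply: le_esum => P /Fdbl; exact: dbl.
rewrite esumZ//; last exact: ltW.
apply: lee_wpmul2l; first by rewrite lee_fin ltW.
apply: esum_measure_le => // P FP; apply: aesub_trans FQ.
by apply: subset_aesub => x Px; exists P.
Qed.

End Stopping.

(** * Differentiation along cubes *)

Section Differentiation.
Context (R : realType) (d : nat) (n : R).
Local Notation E := (borelRd R d).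
Variables (mu : {measure set E -> \bar R}) (A : R) (D : int -> set (set E)).
Variables (cen : int -> set E -> 'rV[R]_d) (rad : int -> set E -> R).
Hypotheses (mu_radon : radon mu) (mu_growth : polynomial_growth mu n).
Hypothesis dm : david_mattila mu D cen rad A.
Local Notation aesub := (aesub mu).
Local Notation aedisj := (aedisj mu).
Implicit Types (P Q S T : set E) (U : set 'rV[R]_d).

Lemma ratio_exp (m : nat) : m%:R <= A ^+ m.
Proof.
have A2 := ratio_gt2 dm.
apply: (@le_trans _ _ (2 ^+ m)).
  by rewrite -natrX ler_nat ltnW// ltn_expl.
by rewrite lerXn2r ?nnegrE//; lra.
Qed.

Lemma small_radius (r : R) : 0 < r ->
  exists m : nat, forall Q, D m Q -> 28 * rad m Q <= r.
Proof.
move=> r0; have [c c0 cP] := dm_radius dm; have A0 := ratio_gt0 dm.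
pose m := Num.bound (28 * c / r).
have mP : 28 * c / r < m%:R by apply: archi_boundP; rewrite divr_ge0 ?mulr_ge0// ltW.
exists m => Q /cP[_ radm].
apply: (@le_trans _ _ (28 * (c * A ^ (- m%:Z)))); first by rewrite ler_wpM2l.
rewrite -exprnN mulrA ler_pdivrMr ?exprn_gt0//.
rewrite -ler_pdivrMl// mulrC; apply: (le_trans (ltW mP)); exact: ratio_exp.
Qed.

(** The cubes of every generation cover the support, and their containing balls
    shrink uniformly. *)
Lemma open_covered U : open U ->
  aesub U (\bigcup_(Q in [set Q | exists2 m : nat, D m Q & aesub Q U]) Q).
Proof.
move=> oU.
have cover (m : nat) : {ae mu, forall x, msupport mu x -> exists2 Q, D m Q & Q x}.
  have [_ cov] := dm_cover dm m; apply: negligibleS cov => x /= /not_implyP[sx nx].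
  by split=> // -[Q DQ Qx]; apply: nx; exists Q.
have ball (m : nat) : {ae mu, forall x, forall Q, D m Q -> Q x ->
    eball (cen m Q) (28 * rad m Q) x}.
  have N : mu.-negligible (\bigcup_(Q in D m) (Q `\` eball (cen m Q) (28 * rad m Q))).
    apply: negligible_countable_bigcup; first exact: (countable_generation mu_growth dm).
    by move=> Q /(dm_ball dm)[].
  apply: negligibleS N => x /= /existsNP[Q /not_implyP[DQ /not_implyP[Qx nx]]].
  by exists Q.
have supp : {ae mu, forall x, msupport mu x} by exact: msupport_negligible.
suff H : {ae mu, forall x, U x ->
    (\bigcup_(Q in [set Q | exists2 m : nat, D m Q & aesub Q U]) Q) x}.
  by apply: negligibleS H => x [Ux Vx] /(_ Ux).
apply: filterS3 (ae_foralln cover) (ae_foralln ball) supp => x coverx ballx sx Ux.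
have [r r0 rU] := eball_nbhs oU Ux; have [m mr] := small_radius r0.
have [Q DQ Qx] := coverx m sx; exists Q => //; exists m => //.
have [_ QB] := dm_ball dm DQ; apply: (aesub_trans QB); apply: subset_aesub.
have small : eball (cen m Q) (28 * rad m Q) `<=` eball (cen m Q) r.
  by move=> y By; exact: lt_le_trans By (mr Q DQ).
move=> y /small; apply: rU; apply: small; exact: ballx.
Qed.

Section Bound.
Variables (h : E -> \bar R) (lambda : R).
Hypotheses (mh : measurable_fun setT h) (h0 : forall x, (0 <= h x)%E).
Hypothesis lambda0 : 0 < lambda.
Hypothesis cube_bound : forall Q, cubes D Q ->
  (\int[mu]_(x in Q) h x <= lambda%:E * mu Q)%E.

(** The cubes of nonnegative generation that are maximal among those inside an
    open set form a disjoint cover of it; bounding the generation below makes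
    maximal cubes exist. *)
Lemma open_bound U : open U -> (\int[mu]_(x in U) h x <= lambda%:E * mu U)%E.
Proof.
move=> oU; have mU := open_measurableRd oU.
pose sel := [set Q | exists m : nat, [/\ D m Q, aesub Q U &
  forall j : nat, (j < m)%N -> forall S, D j S -> aesub Q S -> ~ aesub S U]].
have csel : countable sel.
  apply: sub_countable (countable_cubes mu_growth dm).
  by apply: subset_card_le => Q [m [DQ _ _]]; exists m.
have sel_cube Q : sel Q -> cubes D Q by move=> [m [DQ _ _]]; exists m.
have msel Q : sel Q -> measurable Q by move=> /sel_cube; exact: (cube_measurable dm).
have selU Q : sel Q -> aesub Q U by move=> [m []].
have dsel : pairwise_aedisj mu sel.
  suff H (P Q : set E) (m j : nat) : (j <= m)%N -> D m P -> D j Q ->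
      (forall i : nat, (i < m)%N -> forall S, D i S -> aesub P S -> ~ aesub S U) ->
      aesub Q U -> P <> Q -> aedisj P Q.
    move=> P Q [m [DP PU selP]] [j [DQ QU selQ]] PQ.
    have [jm|/ltnW mj] := leqP j m; first exact: (H P Q m j).
    by apply: aedisj_sym; apply: (H Q P j m) => //; exact/nesym.
  rewrite leq_eqVlt => /predU1P[->|jm] DP DQ selP QU PQ.
    exact: (dm_disjoint dm DP DQ).
  apply: contrapT => nPQ; apply: (selP j jm Q DQ _ QU).
  by apply: (coarser_contains dm _ DP DQ nPQ); lia.
have Usel : aesub U (\bigcup_(Q in sel) Q).
  apply: (aesub_trans (open_covered oU)); apply: aesub_bigcup.
    apply: sub_countable (countable_cubes mu_growth dm).
    by apply: subset_card_le => Q [m DQ _]; exists m.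
  move=> Q [m DQ QU].
  pose inside (j : nat) := asbool (exists S, [/\ D j S, aesub Q S & aesub S U]).
  have [|j /asboolP[S [DS QS SU]] minj] := @ex_minnP inside.
    by exists m; apply/asboolP; exists Q; split=> //; exact: aesub_refl.
  apply: (aesub_trans QS); apply: subset_aesub => x Sx; exists S => //.
  exists j; split=> // i ij T DT ST TU.
  suff : (j <= i)%N by rewrite leqNgt ij.
  by apply: minj; apply/asboolP; exists T; split=> //; exact: aesub_trans ST.
apply: le_trans (integral_le_esum csel msel mh h0 mU Usel) _.
apply: (@le_trans _ _ (\esum_(Q in sel) (lambda%:E * mu Q))%E).
  by apply: le_esum => Q /sel_cube; exact: cube_bound.
rewrite esumZ//; last exact: ltW.
apply: lee_wpmul2l; first by rewrite lee_fin ltW.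
exact: esum_measure_le.
Qed.

Lemma measurable_bound B : measurable B ->
  (\int[mu]_(x in B) h x <= lambda%:E * mu B)%E.
Proof.
move=> mB; rewrite -lee_pdivrMl//; have [_ outer _] := mu_radon.
rewrite (outer B mB); apply: le_ereal_inf_tmp => _ [U [oU BU] <-].
rewrite lee_pdivrMl//; apply: le_trans (open_bound oU).
apply: ae_le_integral => //; first exact: open_measurableRd.
exact: subset_aesub.
Qed.

(** Outer regularity transfers the bound on averages from cubes to the set
    where h exceeds lambda, which must then be null. *)
Lemma bound_ae : {ae mu, forall x, (h x <= lambda%:E)%E}.
Proof.
pose B (m k : nat) : set E :=
  eball 0 m%:R `&` [set x | ((lambda + k.+1%:R^-1)%:E <= h x)%E].
have mB m k : measurable (B m k).
  apply: measurableI; first exact: eball_measurable.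
  by rewrite -[X in measurable X]setTI; exact: emeasurable_fun_c_infty.
have B0 m k : mu.-negligible (B m k).
  apply/(negligibleP mu (mB m k)).
  have fin : mu (B m k) \is a fin_num.
    rewrite ge0_fin_numE//; apply: le_lt_trans (growth_fin_num 0 m%:R mu_growth).
    by apply: le_measure; rewrite ?inE//; [exact: eball_measurable|exact: subIsetl].
  have : (\int[mu]_(x in B m k) (lambda + k.+1%:R^-1)%:E <= lambda%:E * mu (B m k))%E.
    apply: le_trans (measurable_bound (mB m k)); apply: ge0_le_integral => //.
    - by move=> x _; rewrite lee_fin addr_ge0 ?invr_ge0// ltW.
    - exact: measurable_funTS.
    - by move=> x [].
  rewrite integral_cst// -(fineK fin) -!EFinM lee_fin mulrDl gerDl.
  rewrite pmulr_rle0 ?invr_gt0// => H.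
  have z : fine (mu (B m k)) = 0 by apply/eqP; rewrite eq_le H fine_ge0.
  by transitivity (fine (mu (B m k)))%:E; [exact/esym/fineK|rewrite z].
have N : mu.-negligible (\bigcup_m \bigcup_k B m k).
  by apply: negligible_bigcup => m; apply: negligible_bigcup => k.
apply: negligibleS N => x /= /negP; rewrite -ltNge => hx.
have [m _ mx] : (\bigcup_m eball (0 : 'rV[R]_d) m%:R) x by rewrite bigcup_eball.
have [k kx] : exists k : nat, ((lambda + k.+1%:R^-1)%:E <= h x)%E.
  case hE : (h x) hx => [r| |//]; last by exists 0%N; rewrite leey.
  by rewrite lte_fin => /ltr_add_invr[k /ltW kr]; exists k; rewrite lee_fin.
by exists m => //; exists k.
Qed.

End Bound.

End Differentiation.

(** * Unconditional sums of real families *)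

Section RealSums.
Context (R : realType) (I : choiceType).
Implicit Types (A : set I) (u v : I -> R).

Lemma esum_partition (K : choiceType) (B : K -> set I) A (w : I -> \bar R) :
  (forall i, (0 <= w i)%E) -> A = \bigcup_k B k ->
  (forall k l i, B k i -> B l i -> k = l) ->
  (\esum_(k in [set: K]) \esum_(i in B k) w i = \esum_(i in A) w i)%E.
Proof.
move=> w0 AB uniqB.
transitivity (\esum_(k in [set: K]) \esum_(i in A) (if i \in B k then w i else 0))%E.
  apply: eq_esum => k _; rewrite -esum_mkcondr; congr esum.
  by apply/seteqP; split=> [i Bi|i []//]; split=> //; rewrite AB; exists k.
rewrite esum_exchange; last by move=> k i _ _; case: ifP.
apply: eq_esum => i; rewrite AB => -[k _ Bki].
rewrite (@esum_single _ _ _ _ k)//; first by rewrite mem_set.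
  by case: ifP.
move=> l _ lk; rewrite memNset// => Bli; apply: lk; exact: uniqB Bli Bki.
Qed.

Lemma rsum_single A u a : A a -> (forall i, A i -> i <> a -> u i = 0) ->
  rsum A u = u a.
Proof.
move=> Aa u0.
have z i : A i -> i <> a -> (EFin \o u) i = 0%E by move=> Ai ia; rewrite /= u0.
rewrite /rsum (@esum_single _ _ _ _ a)//; last first.
  by move=> i Ai ia; rewrite funeposE z// maxxx.
rewrite (@esum_single _ _ _ _ a)//; last first.
  by move=> i Ai ia; rewrite funenegE z// oppe0 maxxx.
by rewrite -[X in fine X]/(((EFin \o u)^\+ \- (EFin \o u)^\-)%E a) -funeposneg.
Qed.

(** If the family is not summable, the left side may be a junk value, but then
    the right side is infinite. *)
Lemma abs_rsum_le A u : (`|rsum A u|%:E <= \esum_(i in A) `|(u i)%:E|)%E.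
Proof.
rewrite /rsum; set P := (\esum_(i in A) _)%E; set N := (\esum_(i in A) _)%E.
have P0 : (0 <= P)%E by exact: esum_ge0.
have N0 : (0 <= N)%E by exact: esum_ge0.
rewrite (_ : (\esum_(i in A) `|(u i)%:E|)%E = (P + N)%E); last first.
  rewrite -esumD//; apply: eq_esum => i _.
  by rewrite -[LHS]/((abse \o (EFin \o u)) i) fune_abse.
case: P P0 => [p| |]//= p0; case: N N0 => [m| |]//= m0; rewrite ?normr0 ?leey//.
rewrite lee_fin in p0; rewrite lee_fin in m0.
by rewrite -EFinD lee_fin; apply: le_trans (ler_normB _ _) _; rewrite !ger0_norm.
Qed.

Lemma rsumB A u v : (forall i, A i -> 0 <= u i) -> (forall i, A i -> 0 <= v i) ->
  (\esum_(i in A) (u i)%:E < +oo)%E -> (\esum_(i in A) (v i)%:E < +oo)%E ->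
  rsum A (fun i => u i - v i) =
  fine (\esum_(i in A) (u i)%:E) - fine (\esum_(i in A) (v i)%:E).
Proof.
move=> u0 v0 su sv.
have fu : (\esum_(i in A) (u i)%:E)%E \is a fin_num.
  by rewrite ge0_fin_numE//; apply: esum_ge0 => i /u0.
have fv : (\esum_(i in A) (v i)%:E)%E \is a fin_num.
  by rewrite ge0_fin_numE//; apply: esum_ge0 => i /v0.
rewrite -fineB// -(@esumB _ _ A (EFin \o u) (EFin \o v))//.
- rewrite /summable (eq_esum (b := EFin \o u))// => i Ai.
  by rewrite /= ger0_norm// u0.
- rewrite /summable (eq_esum (b := EFin \o v))// => i Ai.
  by rewrite /= ger0_norm// v0.
Qed.

Lemma eq_rsum A u v : (forall i, A i -> u i = v i) -> rsum A u = rsum A v.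
Proof.
move=> uv; rewrite /rsum; congr (fine (_ - _)%E); apply: eq_esum => i /uv.
  by rewrite !funeposE/= => ->.
by rewrite !funenegE/= => ->.
Qed.

Lemma measurable_rsum d (T : measurableType d) A (u : I -> T -> R) :
  countable A -> (forall i, A i -> measurable_fun setT (u i)) ->
  measurable_fun setT (fun x => rsum A (u ^~ x)).
Proof.
move=> cA mu; apply: measurableT_comp => //; apply: emeasurable_funB.
  rewrite (_ : (fun x => _) = fun x => \esum_(i in A) (EFin \o u i)^\+%E x).
    apply: measurable_esum => // i Ai.
    by apply: measurable_funepos; apply/measurable_EFinP; exact: mu.
  by apply/funext => x; apply: eq_esum => i _; rewrite !funeposE.
rewrite (_ : (fun x => _) = fun x => \esum_(i in A) (EFin \o u i)^\-%E x).
  apply: measurable_esum => // i Ai.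
  by apply: measurable_funeneg; apply/measurable_EFinP; exact: mu.
by apply/funext => x; apply: eq_esum => i _; rewrite !funenegE.
Qed.

End RealSums.

(** * Spreading the stopped mass over parents *)

Section Spread.
Context (R : realType) (d : nat).
Local Notation E := (borelRd R d).
Variables (mu : {measure set E -> \bar R}) (M : set (set E)) (par : set E -> set E).
Variables (f : E -> R) (lambda : R).
Hypotheses (cM : countable M) (mM : forall Q, M Q -> measurable Q).
Hypothesis dM : pairwise_aedisj mu M.
Hypothesis mpar : forall Q, M Q -> measurable (par Q).
Hypothesis subpar : forall Q, M Q -> aesub mu Q (par Q).
Hypothesis finpar : forall Q, M Q -> (mu (par Q) < +oo)%E.
Hypothesis pospar : forall Q, M Q -> (0 < mu (par Q))%E.
Hypothesis nested : forall Q S, M Q -> M S -> [\/ aesub mu (par Q) (par S),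
  aesub mu (par S) (par Q) | aedisj mu (par Q) (par S)].
Hypotheses (f0 : forall x, 0 <= f x) (intf : mu.-integrable setT (EFin \o f)).
Hypothesis lambda0 : 0 < lambda.
Hypothesis avgpar : forall Q, M Q ->
  (\int[mu]_(x in par Q) (f x)%:E <= lambda%:E * mu (par Q))%E.
Local Open Scope ereal_scope.
Local Notation mass Q := (\int[mu]_(x in Q) (f x)%:E).
Implicit Types Q S : set E.

Let mf : measurable_fun setT (EFin \o f).
Proof. exact: measurable_int intf. Qed.

Let Ef0 x : 0 <= (EFin \o f) x.
Proof. by rewrite lee_fin. Qed.

(** The value on par Q of the conditional expectation of f restricted to Q, for
    a sigma-algebra of which par Q is an atom. *)
Definition coef Q : R := ((fine (mu (par Q)))^-1 * fine (mass Q))%R.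

Definition spread_term Q (x : E) : R := (coef Q * \1_(par Q) x)%R.

Definition spread (x : E) : \bar R := \esum_(Q in M) (spread_term Q x)%:E.

Lemma mass_ge0 Q : 0 <= mass Q.
Proof. by apply: integral_ge0 => x _; exact: Ef0. Qed.

Lemma coef_ge0 Q : (0 <= coef Q)%R.
Proof. by rewrite mulr_ge0 ?invr_ge0 ?fine_ge0//; exact: mass_ge0. Qed.

Lemma spread_term_ge0 Q x : (0 <= spread_term Q x)%R.
Proof. by rewrite mulr_ge0// coef_ge0. Qed.

Lemma spread_ge0 x : 0 <= spread x.
Proof. by apply: esum_ge0 => Q _; rewrite lee_fin spread_term_ge0. Qed.

Lemma esum_mass_le : \esum_(Q in M) mass Q <= mass setT.
Proof.
by apply: esum_integral_le => // Q _; exact: subset_aesub.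
Qed.

Lemma total_mass_lty : mass setT < +oo.
Proof.
rewrite -ge0_fin_numE; last exact: mass_ge0.
exact: integrable_fin_num intf.
Qed.

Lemma coefM Q : M Q -> (coef Q)%:E * mu (par Q) = mass Q.
Proof.
move=> MQ; have fin : mu (par Q) \is a fin_num by rewrite ge0_fin_numE// finpar.
have pos : (0 < fine (mu (par Q)))%R by rewrite fine_gt0// pospar// finpar.
have mfin : mass Q \is a fin_num.
  rewrite ge0_fin_numE ?mass_ge0//; apply: le_lt_trans total_mass_lty.
  apply: ae_le_integral => //; [exact: mM|exact: subset_aesub].
rewrite -[X in _ * X](fineK fin) -[RHS](fineK mfin) -EFinM /coef; congr EFin.
by rewrite mulrAC mulVf ?mul1r// gt_eqF.
Qed.

Lemma measurable_spread_term Q : M Q -> measurable_fun setT (spread_term Q).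
Proof.
move=> MQ; apply: measurable_funM; first exact: measurable_cst.
by apply: measurable_indic; exact: mpar.
Qed.

Lemma measurable_spread : measurable_fun setT spread.
Proof.
apply: measurable_esum => // [Q MQ|Q x MQ]; last by rewrite lee_fin spread_term_ge0.
by apply/measurable_EFinP; exact: measurable_spread_term.
Qed.

Lemma integral_spread_term Q : M Q -> \int[mu]_x (spread_term Q x)%:E = mass Q.
Proof.
move=> MQ; under eq_integral do rewrite EFinM.
rewrite ge0_integralZl//; last by rewrite lee_fin coef_ge0.
  by rewrite integral_indic ?setIT ?coefM//; exact: mpar.
by apply/measurable_EFinP/measurable_indic; exact: mpar.
Qed.

Lemma integral_spread : \int[mu]_x spread x = \esum_(Q in M) mass Q.
Proof.
rewrite integral_esum//; first by apply: eq_esum => Q MQ; exact: integral_spread_term.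
  by move=> Q MQ; apply/measurable_EFinP; exact: measurable_spread_term.
by move=> Q x MQ; rewrite lee_fin spread_term_ge0.
Qed.

Lemma spread_finite : {ae mu, forall x, spread x < +oo}.
Proof.
have ints : mu.-integrable setT spread.
  apply/integrableP; split; first exact: measurable_spread.
  under eq_integral do rewrite gee0_abs ?spread_ge0//.
  by rewrite integral_spread; apply: le_lt_trans esum_mass_le total_mass_lty.
apply: filterS (integrable_ae measurableT ints) => x /(_ I).
by rewrite ge0_fin_numE// spread_ge0.
Qed.

Lemma integral_spread_pair Q S : M Q -> M S ->
  \int[mu]_x (spread_term Q x * spread_term S x)%:E =
  (coef Q * coef S)%:E * mu (par Q `&` par S).
Proof.
move=> MQ MS.
have mQS : measurable (par Q `&` par S) by apply: measurableI; exact: mpar.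
under eq_integral => x _.
  rewrite /spread_term mulrACA -[(\1_(par Q) x * _)%R]/((\1_(par Q) \* \1_(par S))%R x).
  rewrite -indicI EFinM; over.
rewrite ge0_integralZl//; last by rewrite lee_fin mulr_ge0 ?coef_ge0.
  by rewrite integral_indic ?setIT.
by apply/measurable_EFinP/measurable_indic.
Qed.

Definition inner_term Q S : \bar R :=
  if asbool (aesub mu (par S) (par Q)) then (coef Q)%:E * mass S else 0.

Lemma inner_term_ge0 Q S : 0 <= inner_term Q S.
Proof.
by rewrite /inner_term; case: ifP => // _; rewrite mule_ge0 ?mass_ge0// lee_fin coef_ge0.
Qed.

(** Of two overlapping parents one contains the other; the smaller one then
    gives back the mass it spreads. *)
Lemma spread_pair_le Q S : M Q -> M S ->
  (coef Q * coef S)%:E * mu (par Q `&` par S) <= inner_term Q S + inner_term S Q.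
Proof.
move=> MQ MS.
have mQS : measurable (par Q `&` par S) by apply: measurableI; exact: mpar.
have half P T : M P -> M T -> aesub mu (par T) (par P) ->
    (coef P * coef T)%:E * mu (par P `&` par T) <= inner_term P T.
  move=> MP MT TP; rewrite /inner_term asboolT// -coefM// EFinM -muleA.
  apply: lee_wpmul2l; first by rewrite lee_fin coef_ge0.
  apply: lee_wpmul2l; first by rewrite lee_fin coef_ge0.
  apply: le_measure; rewrite ?inE; [|exact: mpar|exact: subIsetr].
  by apply: measurableI; exact: mpar.
have [QS|SQ|QS] := nested MQ MS.
- rewrite setIC mulrC; apply: le_trans (half S Q MS MQ QS) _.
  by rewrite leeDr// inner_term_ge0.
- apply: le_trans (half Q S MQ MS SQ) _.
  by rewrite leeDl// inner_term_ge0.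
- move/(negligibleP mu mQS) : QS => ->.
  by rewrite mule0 adde_ge0// inner_term_ge0.
Qed.

(** For fixed Q the disjoint cubes S with par S in par Q lie in par Q,
    where the average of f is at most lambda. *)
Lemma esum_inner_term : \esum_(Q in M) \esum_(S in M) inner_term Q S <=
  lambda%:E * mass setT.
Proof.
apply: (@le_trans _ _ (\esum_(Q in M) (lambda%:E * mass Q))); last first.
  rewrite esumZ; [|exact: ltW|exact: mass_ge0].
  by apply: lee_wpmul2l; [rewrite lee_fin ltW|exact: esum_mass_le].
apply: le_esum => Q MQ.
rewrite (_ : \esum_(S in M) _ = (coef Q)%:E *
    \esum_(S in M `&` [set S | aesub mu (par S) (par Q)]) mass S); last first.
  rewrite esum_mkcondr -esumZ ?coef_ge0//; last first.
    by move=> S; case: ifP => // _; exact: mass_ge0.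
  apply: eq_esum => S _; rewrite /inner_term.
  have [SQ|SQ] := pselect (aesub mu (par S) (par Q)).
    by rewrite asboolT// mem_set.
  by rewrite asboolF// memNset// mule0.
apply: (@le_trans _ _ ((coef Q)%:E * mass (par Q))).
  apply: lee_wpmul2l; first by rewrite lee_fin coef_ge0.
  apply: esum_integral_le => //.
  - by apply: sub_countable cM; apply: subset_card_le => S [].
  - by move=> S [MS _]; exact: mM.
  - by move=> P S [MP _] [MS _]; exact: dM.
  - exact: mpar.
  - by move=> S [MS SQ]; exact: aesub_trans (subpar MS) SQ.
rewrite -(coefM MQ) muleCA; apply: lee_wpmul2l; first by rewrite lee_fin coef_ge0.
exact: avgpar.
Qed.

Lemma integral_spread_sq :
  \int[mu]_x (spread x * spread x) <= (2 * lambda)%:E * mass setT.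
Proof.
pose W x := \esum_(Q in M) \esum_(S in M) (spread_term Q x * spread_term S x)%:E.
have term_ge0 Q S x : 0 <= (spread_term Q x * spread_term S x)%:E.
  by rewrite lee_fin mulr_ge0// spread_term_ge0.
have mterm Q S : M Q -> M S ->
    measurable_fun setT (fun x => (spread_term Q x * spread_term S x)%:E).
  move=> MQ MS; apply/measurable_EFinP.
  by apply: measurable_funM; exact: measurable_spread_term.
have minner Q : M Q -> measurable_fun setT
    (fun x => \esum_(S in M) (spread_term Q x * spread_term S x)%:E).
  by move=> MQ; apply: measurable_esum => // S MS; exact: mterm.
have inner_ge0 Q x : 0 <= \esum_(S in M) (spread_term Q x * spread_term S x)%:E.
  by apply: esum_ge0.
(* the square expands into the double sum where the spread is finite *)
apply: (@le_trans _ _ (\int[mu]_x W x)).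
  apply: ae_ge0_le_integral => //.
  - by move=> x _; rewrite mule_ge0// spread_ge0.
  - by apply: emeasurable_funM; exact: measurable_spread.
  - by move=> x _; exact: esum_ge0.
  - exact: measurable_esum.
  apply: filterS spread_finite => x finx _.
  have fin : spread x \is a fin_num by rewrite ge0_fin_numE// spread_ge0.
  have fine0 : (0 <= fine (spread x))%R by rewrite fine_ge0// spread_ge0.
  rewrite -{1}(fineK fin) -esumZ//; last first.
    by move=> Q; rewrite lee_fin spread_term_ge0.
  rewrite /W; apply: le_esum => Q MQ; rewrite muleC fineK// -esumZ.
  - by apply: le_esum => S MS; rewrite -EFinM.
  - exact: spread_term_ge0.
  - by move=> S; rewrite lee_fin spread_term_ge0.
rewrite integral_esum//.
apply: (@le_trans _ _ (\esum_(Q in M) (\esum_(S in M) inner_term Q S +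
    \esum_(S in M) inner_term S Q))).
  apply: le_esum => Q MQ; rewrite integral_esum//; last by move=> S; exact: mterm.
  rewrite -esumD => [|S _|S _]; [|exact: inner_term_ge0..].
  by apply: le_esum => S MS; rewrite integral_spread_pair//; exact: spread_pair_le.
rewrite esumD => [|Q _|Q _]; [|by apply: esum_ge0 => S _; exact: inner_term_ge0..].
rewrite [X in _ + X]esum_exchange; last by move=> S Q _ _; exact: inner_term_ge0.
rewrite mulr_natl mulr2n EFinD ge0_muleDl ?lee_fin ?(ltW lambda0)//.
by apply: leeD; exact: esum_inner_term.
Qed.

End Spread.

(** * The decomposition *)

Lemma Lnorm2_sq d (T : measurableType d) (R : realType)
    (mu : {measure set T -> \bar R}) (g : T -> R) :
  ('N[mu]_2%:E[EFin \o g] ^+ 2 = \int[mu]_x (g x * g x)%:E)%E.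
Proof.
have -> : (\int[mu]_x (g x * g x)%:E = \int[mu]_x (`|(EFin \o g) x| `^ 2))%E.
  apply: eq_integral => x _; rewrite -[(`|_|)%E]/(`|g x|%:E) poweR_EFin powR_mulrn//.
  by rewrite real_normK ?num_real// expr2.
rewrite -poweR_Lnorm//; have := Lnorm_ge0 mu 2%:E (EFin \o g).
case: ('N[mu]_2%:E[EFin \o g])%E => [r| |]//.
  by rewrite lee_fin => r0; rewrite poweR_EFin powR_mulrn// EFin_expe.
by move=> _; rewrite poweRyr// expe2 mulyy.
Qed.

Section Decomposition.
Context (R : realType) (d : nat) (n : R).
Local Notation E := (borelRd R d).
Variables (mu : {measure set E -> \bar R}) (A : R) (D : int -> set (set E)).
Variables (cen : int -> set E -> 'rV[R]_d) (rad : int -> set E -> R).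
Hypotheses (mu_radon : radon mu) (mu_growth : polynomial_growth mu n).
Hypothesis dm : david_mattila mu D cen rad A.
Variable Q0 : set E.
Hypothesis dQ0 : doubling_cubes mu D cen rad Q0.
Local Notation parent := (smallest_doubling_above mu D cen rad).
Local Notation Pi := (sigma_atoms mu D cen rad Q0).
Variables (f : E -> R) (lambda : R).
Hypotheses (f0 : forall x, 0 <= f x) (intf : mu.-integrable setT (EFin \o f)).
Hypothesis lambda0 : 0 < lambda.
Hypothesis lambda_large : (mu setT < +oo)%E ->
  fine (\int[mu]_x (f x)%:E) / fine (mu setT) < lambda.
Local Notation M := [set Q | maximal_cube mu Pi f lambda Q].
Local Notation stopped k := (maximal_in mu Pi f lambda k).
Local Notation G := (unstopped mu D cen rad Q0 f lambda).
Variable par : set E -> set E.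
Hypothesis parP : forall Q, M Q -> parent Q (par Q) /\ avg mu f (par Q) <= lambda.
Implicit Types (P Q S : set E) (k l : int) (x : E).

Let mf : measurable_fun setT (EFin \o f).
Proof. exact: measurable_int intf. Qed.

Let Ef0 x : (0 <= (EFin \o f) x)%E.
Proof. by rewrite lee_fin. Qed.

Let cM : countable M.
Proof. exact: countable_maximal mu_growth dm _ dQ0 f lambda. Qed.

Let mM Q : M Q -> measurable Q.
Proof. exact: (maximal_measurable dm dQ0). Qed.

Let dM : pairwise_aedisj mu M.
Proof. exact: (maximal_disjoint mu_growth dm dQ0). Qed.

Let par_cube Q : M Q -> cubes D (par Q).
Proof. by move=> /parP[[/doubling_cube]]. Qed.

Let mpar Q : M Q -> measurable (par Q).
Proof. by move=> /par_cube; exact: (cube_measurable dm). Qed.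

Let subpar Q : M Q -> aesub mu Q (par Q).
Proof. by move=> /parP[[_ []]]. Qed.

Let finpar Q : M Q -> (mu (par Q) < +oo)%E.
Proof. by move=> /par_cube; exact: (cube_finite mu_growth dm). Qed.

Let pospar Q : M Q -> (0 < mu (par Q))%E.
Proof. by move=> /par_cube; exact: (cube_positive dm). Qed.

Let nested Q S : M Q -> M S -> [\/ aesub mu (par Q) (par S),
  aesub mu (par S) (par Q) | aedisj mu (par Q) (par S)].
Proof. by move=> /par_cube cQ /par_cube; exact: (dm_nested dm). Qed.

Let avgpar Q : M Q ->
  (\int[mu]_(x in par Q) (f x)%:E <= lambda%:E * mu (par Q))%E.
Proof.
by move=> MQ; apply/(avg_le mu_growth dm f0 intf) => //; [exact: par_cube|have [] := parP MQ].
Qed.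

Local Notation v := (spread_term mu par f).
Local Notation u Q x := (f x * \1_Q x).
Local Notation h := (spread mu M par f).
Local Notation mass Q := (\int[mu]_(x in Q) (f x)%:E)%E.

Lemma patch_EFin Q x : ((EFin \o f) \_ Q) x = (u Q x)%:E.
Proof.
by rewrite patchE indicE; case: (x \in Q); rewrite ?mulr1 ?mulr0.
Qed.

Lemma stopped_maximal k Q : stopped k Q -> M Q.
Proof. by case. Qed.

Lemma stopped_cover : M = \bigcup_k stopped k.
Proof.
apply/seteqP; split=> [Q MQ|Q [k _ []]//].
by have [[k PQ] _ _] := MQ; exists k.
Qed.

Lemma stopped_unique k l Q : stopped k Q -> stopped l Q -> k = l.
Proof. by move=> [PQ _] [PQ' _]; exact: (atom_unique dm dQ0 PQ PQ'). Qed.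

(** Among the atoms of the previous level only the parent of Q meets Q, so the
    conditional expectation of f restricted to Q lives on that parent. *)
Lemma cz_termE k x Q : stopped k Q -> cz_term mu Pi f k x Q = u Q x - v Q x.
Proof.
move=> sQ; have [PQ MQ] := sQ; have [QP _] := parP MQ.
have PP := atom_parent mu_growth dm dQ0 PQ QP.
rewrite /cz_term; congr (_ - _); rewrite /condexp.
have intP P : measurable P ->
    (\int[mu]_(y in P) (u Q y)%:E = \int[mu]_(y in P `&` Q) (f y)%:E)%E.
  move=> mP; rewrite [RHS]integral_mkcondr; apply: eq_integral => y _.
  by rewrite -patch_EFin.
have mQ := mM MQ.
rewrite (@rsum_single _ _ _ _ (par Q))//; last first.
  move=> P PPk PparQ; rewrite /avg /Rintegral.
  have mP := cube_measurable dm (doubling_cube (atom_doubling dm dQ0 PPk)).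
  rewrite intP// (_ : \int[mu]_(y in P `&` Q) (f y)%:E = 0)%E ?mulr0 ?mul0r//.
  apply/eqP; rewrite eq_le mass_ge0// andbT -(integral_set0 mu (EFin \o f)).
  apply: ae_le_integral => //; first exact: measurableI.
  rewrite /aesub setD0; apply: (aedisjS (aesub_refl mu P) (subpar MQ)).
  exact: (atom_disjoint dm dQ0 PPk PP PparQ).
rewrite /spread_term; congr (_ * _); rewrite /avg /coef /Rintegral; congr (_ * fine _).
have mP := mpar MQ; rewrite intP//; apply/eqP; rewrite eq_le; apply/andP; split.
  by apply: ae_le_integral => //; [exact: measurableI|apply: subset_aesub; exact: subIsetr].
apply: ae_le_integral => //; first exact: measurableI.
by apply: negligibleS (subpar MQ) => y [Qy nPQ]; split=> // Py; apply: nPQ.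
Qed.

Lemma measurable_stopped_part Q : M Q -> measurable_fun setT (fun x => u Q x).
Proof.
move=> MQ; apply/measurable_EFinP.
rewrite (_ : _ \o _ = (EFin \o f) \_ Q); last by apply/funext => x; rewrite patch_EFin.
by apply: measurable_patch => //; exact: mM.
Qed.

Let u0 Q x : 0 <= u Q x.
Proof. by rewrite mulr_ge0. Qed.

Let v0 Q x : 0 <= v Q x.
Proof. exact: spread_term_ge0. Qed.

Let mv Q : M Q -> measurable_fun setT (v Q).
Proof. exact: measurable_spread_term. Qed.

Local Notation phi k := (cz_phi mu Pi f lambda k).

Lemma integral_stopped_part Q : M Q -> (\int[mu]_x (u Q x)%:E = mass Q)%E.
Proof.
by move=> MQ; rewrite [RHS]integral_mkcond; apply: eq_integral => x _; rewrite patch_EFin.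
Qed.

Lemma cz_phiE k : phi k = fun x => rsum (stopped k) (fun Q => u Q x - v Q x).
Proof. by apply/funext => x; apply: eq_rsum => Q /cz_termE. Qed.

Let cstopped k : countable (stopped k).
Proof. by apply: sub_countable cM; apply: subset_card_le => Q []. Qed.

Lemma measurable_cz_phi k : measurable_fun setT (phi k).
Proof.
rewrite cz_phiE; apply: (@measurable_rsum _ _ _ _ _ (fun Q x => u Q x - v Q x)) => //.
move=> Q /stopped_maximal MQ; apply: measurable_funB; last exact: mv.
exact: measurable_stopped_part.
Qed.

Lemma cz_phi_le k x :
  (`|phi k x|%:E <= \esum_(Q in stopped k) (u Q x + v Q x)%:E)%E.
Proof.
rewrite cz_phiE; apply: le_trans (abs_rsum_le _ _) _; apply: le_esum => Q _.
rewrite lee_fin; apply: le_trans (ler_normB _ _) _.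
by rewrite (ger0_norm (u0 Q x)) ger0_norm.
Qed.

Lemma integral_stopped k :
  (\int[mu]_x (\esum_(Q in stopped k) (u Q x + v Q x)%:E) =
   \esum_(Q in stopped k) (2%:E * mass Q))%E.
Proof.
rewrite integral_esum//; last 2 first.
- move=> Q /stopped_maximal MQ; apply/measurable_EFinP; apply: measurable_funD.
    exact: measurable_stopped_part.
  exact: mv.
- by move=> Q x _; rewrite lee_fin addr_ge0.
apply: eq_esum => Q /stopped_maximal MQ.
under eq_integral do rewrite EFinD.
rewrite ge0_integralD//.
- rewrite integral_stopped_part// (integral_spread_term mM mpar finpar pospar f0 intf MQ).
  by rewrite -[RHS]/((1 + 1)%:E * _)%E EFinD ge0_muleDl// mul1e.
- by move=> x _; rewrite lee_fin.
- by apply/measurable_EFinP; exact: measurable_stopped_part.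
- by move=> x _; rewrite lee_fin.
- by apply/measurable_EFinP; exact: mv.
Qed.

Lemma cz_phi_norm k :
  (\int[mu]_x `|phi k x|%:E <= \esum_(Q in stopped k) (2%:E * mass Q))%E.
Proof.
rewrite -integral_stopped; apply: ge0_le_integral => //.
- by apply/measurable_EFinP; apply: measurableT_comp => //; exact: measurable_cz_phi.
- apply: measurable_esum => // [Q /stopped_maximal MQ|Q x _]; last first.
    by rewrite lee_fin addr_ge0.
  apply/measurable_EFinP; apply: measurable_funD; last exact: mv.
  exact: measurable_stopped_part.
- by move=> x _; exact: cz_phi_le.
Qed.

Lemma esum_cz_phi_norm :
  (\esum_(k in [set: int]) \int[mu]_x `|phi k x|%:E <= 2%:E * mass setT)%E.
Proof.
apply: (@le_trans _ _ (\esum_(k in [set: int]) \esum_(Q in stopped k) (2%:E * mass Q))%E).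
  by apply: le_esum => k _; exact: cz_phi_norm.
rewrite (esum_partition (A := M)).
- rewrite esumZ//; last by move=> Q; exact: mass_ge0.
  by apply: lee_wpmul2l => //; exact: esum_mass_le.
- by move=> Q; rewrite mule_ge0//; exact: mass_ge0.
- exact: stopped_cover.
- exact: stopped_unique.
Qed.

(** Almost every point off G lies in exactly one maximal cube. *)
Lemma stopped_part_sum : {ae mu, forall x,
  (\esum_(Q in M) (u Q x)%:E = (f x - u G x)%:E)%E}.
Proof.
apply: filterS (pairwise_aedisj_ae cM dM) => x uniqx.
have [[Q MQ Qx]|nx] := pselect ((\bigcup_(Q in M) Q) x).
  rewrite (@esum_single _ _ _ _ Q)//; last 2 first.
  - by rewrite lee_fin.
  - move=> S MS SQ; rewrite indicE memNset ?mulr0// => Sx.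
    by apply: SQ; exact: uniqx.
  rewrite !indicE mem_set// memNset ?mulr0 ?mulr1 ?subr0//.
  by apply; exists Q.
rewrite esum1 => [|Q MQ]; last first.
  by rewrite indicE memNset ?mulr0// => Qx; apply: nx; exists Q.
by rewrite indicE mem_set ?mulr1 ?subrr.
Qed.

Section GoodPoint.
Variable x : E.
Hypothesis ux : (\esum_(Q in M) (u Q x)%:E = (f x - u G x)%:E)%E.
Hypothesis hx : (h x < +oo)%E.

Lemma esum_stopped_fin (w : set E -> R) : (forall Q, 0 <= w Q) ->
  (\esum_(Q in M) (w Q)%:E < +oo)%E ->
  forall k, (\esum_(Q in stopped k) (w Q)%:E)%E \is a fin_num.
Proof.
move=> w0 wfin k; rewrite ge0_fin_numE; last first.
  by apply: esum_ge0 => Q _; rewrite lee_fin.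
apply: le_lt_trans wfin; apply: esum_sub; first exact: stopped_maximal.
by move=> Q _; rewrite lee_fin.
Qed.

Lemma esum_stopped_fine (w : set E -> R) : (forall Q, 0 <= w Q) ->
  (\esum_(Q in M) (w Q)%:E < +oo)%E ->
  (\esum_(k in [set: int]) (fine (\esum_(Q in stopped k) (w Q)%:E))%:E =
   \esum_(Q in M) (w Q)%:E)%E.
Proof.
move=> w0 wfin; rewrite -(esum_partition (B := fun k => stopped k)).
- by apply: eq_esum => k _; rewrite fineK// esum_stopped_fin.
- by move=> Q; rewrite lee_fin.
- exact: stopped_cover.
- exact: stopped_unique.
Qed.

Let ufin : (\esum_(Q in M) (u Q x)%:E < +oo)%E.
Proof. by rewrite ux ltry. Qed.

Lemma uv_fin : (\esum_(Q in M) (u Q x + v Q x)%:E < +oo)%E.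
Proof.
under eq_esum do rewrite EFinD.
by rewrite esumD => [|Q _|Q _]; rewrite ?lee_fin//; exact: lte_add_pinfty.
Qed.

Lemma summable_cz_term k : summable (stopped k) (EFin \o cz_term mu Pi f k x).
Proof.
apply: le_lt_trans uv_fin.
apply: (@le_trans _ _ (\esum_(Q in stopped k) (u Q x + v Q x)%:E)%E).
  apply: le_esum => Q sQ; rewrite /= cz_termE// lee_fin.
  by apply: le_trans (ler_normB _ _) _; rewrite (ger0_norm (u0 Q x)) ger0_norm.
apply: esum_sub; first exact: stopped_maximal.
by move=> Q _; rewrite lee_fin addr_ge0.
Qed.

Lemma summable_cz_phi : summable [set: int] (fun k => (phi k x)%:E).
Proof.
apply: le_lt_trans uv_fin.
rewrite -(esum_partition (B := fun k => stopped k)).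
- by apply: le_esum => k _; exact: cz_phi_le.
- by move=> Q; rewrite lee_fin addr_ge0.
- exact: stopped_cover.
- exact: stopped_unique.
Qed.

Lemma cz_goodE : cz_good mu Pi f lambda x = u G x + fine (h x).
Proof.
rewrite /cz_good /cz_bad.
have phiE k : phi k x = fine (\esum_(Q in stopped k) (u Q x)%:E)%E -
    fine (\esum_(Q in stopped k) (v Q x)%:E)%E.
  rewrite cz_phiE rsumB// -ge0_fin_numE; try exact: esum_stopped_fin.
  - by apply: esum_ge0 => Q _; rewrite lee_fin.
  - by apply: esum_ge0 => Q _; rewrite lee_fin.
rewrite (eq_rsum (fun k _ => phiE k)) rsumB.
- rewrite !esum_stopped_fine// ux /=; lra.
- by move=> k _; rewrite fine_ge0//; apply: esum_ge0 => Q _; rewrite lee_fin.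
- by move=> k _; rewrite fine_ge0//; apply: esum_ge0 => Q _; rewrite lee_fin.
- by rewrite esum_stopped_fine.
- by rewrite esum_stopped_fine.
Qed.

End GoodPoint.

Lemma spread_part_finite : {ae mu, forall x, (h x < +oo)%E}.
Proof. exact: (spread_finite cM mM dM mpar finpar pospar f0 intf). Qed.

Lemma unstopped_le : {ae mu, forall x, u G x <= lambda}.
Proof.
have mG := unstopped_measurable mu_growth dm dQ0 f lambda.
have b : {ae mu, forall x, (((EFin \o f) \_ G) x <= lambda%:E)%E}.
  apply: (bound_ae mu_radon mu_growth dm) => //.
  - exact: measurable_patch.
  - by move=> x; exact: patch_ge0.
  - exact: (cube_unstopped mu_radon mu_growth dm dQ0 f0 intf lambda0 lambda_large).
by apply: filterS b => x; rewrite patch_EFin lee_fin.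
Qed.

Lemma measurable_cz_good : measurable_fun setT (cz_good mu Pi f lambda).
Proof.
apply: measurable_funB; first by apply/measurable_EFinP.
apply: (@measurable_rsum _ _ _ _ _ (fun k x => phi k x)).
  exact: countableP.
by move=> k _; exact: measurable_cz_phi.
Qed.

(** Off the stopping cubes f is at most lambda; the rest of the good part is
    the spread mass. *)
Lemma integral_cz_good_sq :
  (\int[mu]_x (cz_good mu Pi f lambda x * cz_good mu Pi f lambda x)%:E <=
   (6 * lambda)%:E * mass setT)%E.
Proof.
have mh : measurable_fun setT h by exact: measurable_spread.
have h0 x : (0 <= h x)%E by exact: spread_ge0.
have mhh : measurable_fun setT (fun x => 2%:E * (h x * h x))%E.
  by apply: measurable_funeM; exact: emeasurable_funM.
have mlf : measurable_fun setT (fun x => (2 * lambda)%:E * (f x)%:E)%E.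
  exact: measurable_funeM.
apply: (@le_trans _ _ (\int[mu]_x ((2 * lambda)%:E * (f x)%:E + 2%:E * (h x * h x)))%E).
  apply: ae_ge0_le_integral => //.
  - by move=> x _; rewrite lee_fin -expr2 sqr_ge0.
  - apply/measurable_EFinP; apply: measurable_funM; exact: measurable_cz_good.
  - by move=> x _; rewrite adde_ge0 ?mule_ge0// lee_fin ?mulr_ge0// ltW.
  - exact: emeasurable_funD.
  apply: filterS3 stopped_part_sum spread_part_finite unstopped_le => x ux hx Gx _.
  rewrite (cz_goodE ux hx).
  have hfn : h x \is a fin_num by rewrite ge0_fin_numE.
  rewrite -(fineK hfn) -!EFinM -EFinD lee_fin; set y := fine (h x).
  have G0 : 0 <= u G x by [].
  have Gf : u G x <= f x by rewrite ler_piMr// indicE lern1 leq_b1.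
  have : u G x * u G x <= lambda * f x by exact: ler_pM.
  move: (u G x) => a aa; rewrite -subr_ge0 /=.
  rewrite (_ : _ - _ = 2 * (lambda * f x - a * a) + (a - y) ^+ 2); last by ring.
  by rewrite addr_ge0 ?sqr_ge0// mulr_ge0// subr_ge0.
rewrite ge0_integralD//.
- rewrite ge0_integralZl//; last by rewrite lee_fin mulr_ge0// ltW.
  rewrite ge0_integralZl//; last first.
  - by move=> x _; rewrite mule_ge0.
  - exact: emeasurable_funM.
  rewrite (_ : 6 * lambda = 2 * lambda + 2 * (2 * lambda)); last by lra.
  rewrite [in leRHS]EFinD [leRHS]ge0_muleDl ?lee_fin ?mulr_ge0 ?(ltW lambda0)//.
  apply: leeD => //; rewrite EFinM -muleA; apply: lee_wpmul2l => //.
  exact: (integral_spread_sq cM mM dM mpar subpar finpar pospar nested f0 intf lambda0 avgpar).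
- by move=> x _; rewrite lee_fin.
- by move=> x _; rewrite mule_ge0// lee_fin ?mulr_ge0// ltW.
- by move=> x _; rewrite !mule_ge0.
Qed.

End Decomposition.

Theorem theorem3p2 (R : realType) (d : nat) (n : R) (hd : (0 < d)%N)
    (hn : 0 < n) :
  exists2 C : R, 0 < C &
  forall (mu : {measure set (borelRd R d) -> \bar R}),
    radon mu -> polynomial_growth mu n ->
  forall (A : R) (D : int -> set (set (borelRd R d)))
    (cen : int -> set (borelRd R d) -> 'rV[R]_d)
    (rad : int -> set (borelRd R d) -> R),
    david_mattila mu D cen rad A ->
  forall Q0 : set (borelRd R d), doubling_cubes mu D cen rad Q0 ->
  forall (f : borelRd R d -> R) (lambda : R),
    (forall x, 0 <= f x) -> mu.-integrable setT (EFin \o f) ->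
    0 < lambda ->
    ((mu setT < +oo)%E ->
       fine ('N[mu]_1[EFin \o f])%E / fine (mu setT) < lambda) ->
  let Pi := sigma_atoms mu D cen rad Q0 in
  let phi := cz_phi mu Pi f lambda in
  let bad := cz_bad mu Pi f lambda in
  let g := cz_good mu Pi f lambda in
  [/\ (forall k, {ae mu, forall x, summable (maximal_in mu Pi f lambda k)
                    (EFin \o cz_term mu Pi f k x)}),
      {ae mu, forall x, summable [set: int] (fun k => (phi k x)%:E)},
      (forall k, mu.-integrable setT (EFin \o phi k)) &
      [/\ measurable_fun setT g,
          (forall x, f x = g x + bad x),
          (\esum_(k in [set: int]) 'N[mu]_1[EFin \o phi k]
             <= C%:E * 'N[mu]_1[EFin \o f])%E &
          ('N[mu]_2%:E[EFin \o g] ^+ 2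
             <= (C * lambda)%:E * 'N[mu]_1[EFin \o f])%E]].
Proof.
exists 6 => // mu mu_radon gr A D cen rad dm Q0 dQ0 f lambda f0 intf lambda0.
have -> : ('N[mu]_1[EFin \o f] = \int[mu]_x (f x)%:E)%E.
  by rewrite Lnorm1; apply: eq_integral => x _; rewrite /= ger0_norm.
move=> large Pi phi bad g.
have [par parP] : {par : set (borelRd R d) -> set (borelRd R d) &
    forall Q, maximal_cube mu Pi f lambda Q ->
    smallest_doubling_above mu D cen rad Q (par Q) /\ avg mu f (par Q) <= lambda}.
  apply: (@choice _ _ (fun Q P => maximal_cube mu Pi f lambda Q ->
    smallest_doubling_above mu D cen rad Q P /\ avg mu f P <= lambda)) => Q.
  have [maxQ|nQ] := pselect (maximal_cube mu Pi f lambda Q); last by exists Q.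
  have [P QP avgP] :=
    maximal_parent mu_radon gr dm dQ0 f0 intf lambda0 large maxQ.
  by exists P.
have ux := stopped_part_sum gr dm dQ0 lambda f0.
have hx := spread_part_finite gr dm dQ0 f0 intf parP.
have esum2 := esum_cz_phi_norm gr dm dQ0 f0 intf parP.
have total0 : (0 <= \int[mu]_x (f x)%:E)%E by exact: mass_ge0.
have mphi k : measurable_fun setT (phi k).
  exact: (measurable_cz_phi gr dm dQ0 f0 intf parP).
split.
- move=> k; apply: filterS2 ux hx => x ux hx.
  exact: (summable_cz_term gr dm dQ0 f0 intf parP ux hx).
- apply: filterS2 ux hx => x ux hx.
  exact: (summable_cz_phi gr dm dQ0 f0 intf parP ux hx).
- move=> k; apply/integrableP; split; first by apply/measurable_EFinP.
  apply: le_lt_trans (_ : 2%:E * \int[mu]_x (f x)%:E < +oo)%E; last first.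
    by rewrite lte_mul_pinfty// (total_mass_lty f0 intf).
  apply: le_trans esum2; apply: le_trans (esum_sub (A := [set k]) _ _) => //.
  + by rewrite esum_set1//; apply: integral_ge0.
  + by move=> l _; apply: integral_ge0.
split.
- exact: (measurable_cz_good gr dm dQ0 f0 intf parP).
- by move=> x; rewrite /g /cz_good subrK.
- under eq_esum do rewrite Lnorm1.
  apply: le_trans esum2 _; apply: lee_wpmul2r => //.
  by rewrite lee_fin ler_nat.
- rewrite Lnorm2_sq.
  exact: (integral_cz_good_sq mu_radon gr dm dQ0 f0 intf lambda0 large parP).
Qed.
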